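(* Let $p>0$ and consider the stochastic functional differential equation (SFDE) with Markovian switching $$\mathrm{d}x(t)=f(t,x_t,r(t),u(t))\,\mathrm{d}t+g(t,x_t,r(t),u(t))\,\mathrm{d}w(t),\quad t\in J,$$ described in the context, with $u(t)\equiv0$. Suppose there exist a continuous functional $V(t,\phi,i):J_\tau\times\mathbf{C}([-\tau,0],\mathbf{R}^n)\times\mathbf{S}\to J$, a uniformly stable function $\mu(t)$, and functions $\alpha_1\in\mathcal{VK}_\infty$ and $\alpha_2\in\mathcal{CK}_\infty$ such that the following conditions hold for all $t\in J$: (i) $\alpha_1(|\phi(0)|^p)\le V(t,\phi,i)\le\alpha_2(\|\phi\|^p)$ for all $\phi\in\mathbf{C}([-\tau,0],\mathbf{R}^n)$ and all $i\in\mathbf{S}$; (ii) $\mathbf{E}\{\mathcal{L}_V(t,x_t,i)\}\le\mu(t)\,\mathbf{E}\{V(t,x_t,i)\}$ for all $i\in\mathbf{S}$. Then the SFDE is $p$th moment globally uniformly asymptotically stable (GUAS). If, in addition, there exist three positive numbers $\beta_0,\beta_1,\beta_2$ such that $\alpha_1(s)=\beta_1s^{\beta_0}$ and $\alpha_2(s)=\beta_2s^{\beta_0}$, then the SFDE is $p$th moment globally uniformly exponentially stable (GUES).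
   Context: Notation. $J=[0,\infty)$, $\tau\ge 0$, $J_\tau=[-\tau,\infty)$; $|\cdot|$ is the Euclidean norm; $\mathbf{C}([-\tau,0],\mathbf{R}^n)$ is the space of continuous functions with norm $\|\phi\|=\sup_{-\tau\le\theta\le0}|\phi(\theta)|$. $\mathcal{K},\mathcal{K}_\infty,\mathcal{KL}$ are the usual comparison function classes; $\mathcal{VK}_\infty$ (resp. $\mathcal{CK}_\infty$) is the set of convex (resp. concave) $\mathcal{K}_\infty$ functions. System. $(\Omega,\mathcal{F},\{\mathcal{F}_t\}_{t\ge t_0},\mathbb{P})$ is a complete filtered probability space satisfying the usual conditions, with expectation $\mathbf{E}$; $w$ is an $m$-dimensional Brownian motion; $r(t)$ is a right-continuous Markov chain with values in the finite set $\mathbf{S}=\{1,\dots,N\}$ and generator $\Gamma=(\gamma_{ij})_{N\times N}$ ($\gamma_{ij}\ge0$ for $i\ne j$, $\gamma_{ii}=-\sum_{j\neq i}\gamma_{ij}$), independent of $w$. In the SFDE, $x_t(\theta)=x(t+\theta)$, $\theta\in[-\tau,0]$; the initial condition is $x_{t_0}=\xi\in\mathbf{C}^{\mathrm b}_{\mathcal{F}_{t_0}}([-\tau,0],\mathbf{R}^n)$, the family of bounded $\mathcal{F}_{t_0}$-measurable $\mathbf{C}([-\tau,0],\mathbf{R}^n)$-valued random variables; $f:J\times\mathbf{C}([-\tau,0],\mathbf{R}^n)\times\mathbf{S}\times\mathbf{R}^l\to\mathbf{R}^n$ and $g:J\times\mathbf{C}([-\tau,0],\mathbf{R}^n)\times\mathbf{S}\times\mathbf{R}^l\to\mathbf{R}^{n\times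 m}$ are measurable, $f(t,0,i,0)\equiv0$, $g(t,0,i,0)\equiv0$ for all $t\in J$, $i\in\mathbf{S}$, and are sufficiently smooth so that the SFDE only has continuous solutions on $J$. Stability (with $u\equiv0$, for any initial condition $\xi$, all $t,t_0\in J$, $t\ge t_0$). $p$th moment GUAS: there is $\sigma\in\mathcal{KL}$ with $\mathbf{E}\{|x(t)|^p\}\le\sigma(\mathbf{E}\{\|\xi\|^p\},t-t_0)$. $p$th moment GUES: there are constants $\alpha>0,\beta>0$ with $\mathbf{E}\{|x(t)|^p\}\le\beta\mathrm{e}^{-\alpha(t-t_0)}\mathbf{E}\{\|\xi\|^p\}$. Infinitesimal operator of a functional $V$ along the SFDE: $$\mathcal{L}_V(t,x_t,i)=\lim_{\Delta\to0^+}\frac1\Delta\Big[\mathbf{E}\{V(t+\Delta,x_{t+\Delta},r(t+\Delta))\mid x_t,\,r(t)=i\}-V(t,x_t,i)\Big].$$ Conditions involving $x_t$ are required along the solutions of the SFDE with $u\equiv0$ (every initial time $t_0\in J$ and initial condition $\xi$; $t\ge t_0$). A continuous $\mu:J\to\mathbf{R}$ is a uniformly stable function (USF) if there are constants $\varepsilon>0$, $\delta\ge0$ with $\int_{t_0}^t\mu(s)\,\mathrm{d}s\le-\varepsilon(t-t_0)+\delta$ for all $t\ge t_0$ in $J$ (equivalently $\dot y=\mu(t)y$ is globally uniformly asymptotically stable). *)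

(* Defs.v *)
From HB Require Import structures.
From mathcomp Require Import all_boot all_order all_algebra.
From mathcomp Require Import all_classical all_reals all_analysis.
Set Implicit Arguments.
Unset Strict Implicit.
Unset Printing Implicit Defensive.
Import Order.TTheory GRing.Theory Num.Theory.
Import numFieldNormedType.Exports.
Local Open Scope classical_set_scope.
Local Open Scope ring_scope.

(* The norm that MathComp-Analysis puts on matrices is the sup norm, hence an
   explicit Euclidean norm. *)
Definition enorm (R : realType) (n : nat) (v : 'cV[R]_n) : R :=
  Num.sqrt (\sum_(k < n) v k 0 ^+ 2).

Section ComparisonFunctions.
Context {R : realType}.

Definition classK (a : R -> R) : Prop :=
  [/\ {within `[0, +oo[, continuous a},
      {in `[0, +oo[ &, {homo a : x y / x < y}} &
      a 0 = 0].

Definition classKoo (a : R -> R) : Prop :=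
  classK a /\ a x @[x --> +oo] --> +oo.

Definition classVKoo (a : R -> R) : Prop :=
  classKoo a /\ convex_function (`[0, +oo[%classic : set R) a.

Definition classCKoo (a : R -> R) : Prop :=
  classKoo a /\ convex_function (`[0, +oo[%classic : set R) (fun s => - a s).

Definition classKL (sigma : R -> R -> R) : Prop :=
  (forall t : R, 0 <= t -> classK (sigma ^~ t)) /\
  (forall s : R, 0 <= s ->
     {in `[0, +oo[ &, {homo sigma s : t1 t2 / t1 <= t2 >-> t2 <= t1}} /\
     sigma s t @[t --> +oo] --> 0).

Definition uniformly_stable_function (mu : R -> R) : Prop :=
  {within `[0, +oo[, continuous mu} /\
  exists eps delta : R, [/\ 0 < eps, 0 <= delta &
    forall t0 t : R, 0 <= t0 -> t0 <= t ->
      \int[lebesgue_measure]_(s in `[t0, t]) mu s <= - eps * (t - t0) + delta].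

End ComparisonFunctions.

(* C([-tau,0], R^n): an element is represented by the unique continuous
   function on the whole line that extends it and is constant on ]-oo, -tau]
   and on [0, +oo[. *)
Definition clamp (R : realType) (tau theta : R) : R :=
  Num.max (- tau) (Num.min theta 0).

Record hist (R : realType) (n : nat) (tau : R) := Hist {
  hist_fun :> R -> 'cV[R]_n ;
  hist_continuous : continuous hist_fun ;
  hist_clamp : forall theta, hist_fun (clamp tau theta) = hist_fun theta }.

Lemma clamp_id (R : realType) (tau theta : R) :
  clamp tau (clamp tau theta) = clamp tau theta.
Proof.
rewrite /clamp; have [t0|t0] := leP 0 (- tau).
  by rewrite !max_l// ?ge_min ?t0 ?orbT// (le_trans _ t0)// ge_min lexx orbT.
rewrite [Num.min (Num.max _ _) 0]min_l; last first.
  by rewrite ge_max (ltW t0) ge_min lexx orbT.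
by rewrite max_r// le_max lexx.
Qed.

Section HistorySpace.
Context {R : realType} {n : nat} {tau : R}.
Local Notation hist := (hist n tau).

HB.instance Definition _ := gen_eqMixin hist.
HB.instance Definition _ := gen_choiceMixin hist.

Definition chist (v : 'cV[R]_n) : hist :=
  @Hist R n tau (fun=> v) (fun=> @cst_continuous _ _ v _) (fun=> erefl).

HB.instance Definition _ := isPointed.Build hist (chist 0).

Definition hdist (phi psi : hist) : R :=
  sup [set enorm (phi theta - psi theta) | theta in `[- tau, 0]].

Definition hnorm (phi : hist) : R :=
  sup [set enorm (phi theta) | theta in `[- tau, 0]].

(* The Borel sigma-algebra of the separable space C([-tau,0], R^n) is generated
   by the evaluations. *)
Definition hist_cylinders : set (set hist) :=
  [set A | exists theta k (B : set R),
     measurable B /\ A = [set phi : hist | B (phi theta k 0)]].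

HB.instance Definition _ :=
  @isMeasurable.Build (sigma_display hist_cylinders) hist
    <<s hist_cylinders >> (@sigma_algebra0 _ setT hist_cylinders)
    (@sigma_algebraC _ hist_cylinders)
    (@sigma_algebra_bigcup _ setT hist_cylinders).

(* The segment x_t of a path x, with the zero history as junk value when x is
   not continuous on [t - tau, t]. *)
Definition segment (x : R -> 'cV[R]_n) (t : R) : hist :=
  match pselect (continuous (fun theta => x (t + clamp tau theta))) with
  | left xc => @Hist R n tau _ xc
                 (fun theta => congr1 (fun s => x (t + s)) (clamp_id tau theta))
  | right _ => chist 0
  end.

End HistorySpace.
Arguments segment {R n} tau x t.

(* Joint continuity on [-tau, +oo[ x C([-tau,0], R^n) x S, S being discrete. *)
Definition continuous_functional (R : realType) (n N : nat) (tau : R)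
    (V : R -> hist n tau -> 'I_N -> R) : Prop :=
  forall (t : R) phi i, - tau <= t -> forall e : R, 0 < e ->
    exists2 dlt : R, 0 < dlt & forall (s : R) psi, - tau <= s ->
      `|s - t| < dlt -> hdist psi phi < dlt -> `|V s psi i - V t phi i| < e.

Section Coefficients.
Context {R : realType} {n m l N : nat} {tau : R}.

Definition cV_coordinates : set (set 'cV[R]_l) :=
  [set A | exists k (B : set R),
     measurable B /\ A = [set v : 'cV[R]_l | B (v k 0)]].

Definition measurable_coefficient (h : R -> hist n tau -> 'I_N -> 'cV[R]_l -> R)
    : Prop :=
  forall i, measurable_fun
    [set z : R * hist n tau * g_sigma_algebraType cV_coordinates | 0 <= z.1.1]
    (fun z => h z.1.1 z.1.2 i z.2).

Definition admissible_drift
    (f : R -> hist n tau -> 'I_N -> 'cV[R]_l -> 'cV[R]_n) : Prop :=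
  (forall k, measurable_coefficient (fun t phi i v => f t phi i v k 0)) /\
  (forall (t : R) i, 0 <= t -> f t (chist 0) i 0 = 0).

Definition admissible_diffusion
    (g : R -> hist n tau -> 'I_N -> 'cV[R]_l -> 'M[R]_(n, m)) : Prop :=
  (forall k j, measurable_coefficient (fun t phi i v => g t phi i v k j)) /\
  (forall (t : R) i, 0 <= t -> g t (chist 0) i 0 = 0).

End Coefficients.

Definition meas_wrt (T : Type) d' (T' : measurableType d') (G : set (set T))
    (X : T -> T') : Prop :=
  forall B, measurable B -> G (X @^-1` B).

Section StochasticBasis.
Context {R : realType} {d : measure_display} {Omega : measurableType d}.
Variable P : probability Omega R.
Variable F : R -> set (set Omega).

(* Complete probability space with a filtration (indexed by [0, +oo[)
   satisfying the usual conditions. *)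
Definition usual_conditions : Prop :=
  [/\ measure_is_complete P,
      forall t : R, 0 <= t -> sigma_algebra setT (F t) /\ F t `<=` measurable,
      forall s t : R, 0 <= s -> s <= t -> F s `<=` F t,
      forall (t : R) A, 0 <= t -> (forall s : R, t < s -> F s A) -> F t A &
      P.-negligible `<=` F 0].

(* m-dimensional standard Brownian motion relative to F; the last clause says
   that w t - w s is independent of F s with law N(0, (t - s) I_m). *)
Definition brownian_motion (m : nat) (w : R -> Omega -> 'cV[R]_m) : Prop :=
  [/\ {ae P, forall om, w 0 om = 0},
      {ae P, forall om, {within `[0, +oo[, continuous (w ^~ om)}},
      forall (t : R) k, 0 <= t -> meas_wrt (F t) (fun om => w t om k 0) &
      forall (s t : R) A (B : 'I_m -> set R), 0 <= s -> s < t ->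
        F s A -> (forall k, measurable (B k)) ->
        P (A `&` [set om | forall k, B k ((w t om - w s om) k 0)]) =
        (P A * \prod_(k < m) normal_prob 0 (Num.sqrt (t - s)) (B k))%E].

Definition is_generator (N : nat) (Gamma : 'M[R]_N) : Prop :=
  (forall i j, i != j -> 0 <= Gamma i j) /\
  (forall i, Gamma i i = - \sum_(j < N | j != i) Gamma i j).

Definition transition_function (N : nat) (Gamma : 'M[R]_N) (p : R -> 'M[R]_N)
    : Prop :=
  [/\ p 0 = 1%:M,
      forall s t : R, 0 <= s -> 0 <= t -> p (s + t) = p s *m p t,
      forall (t : R) i, 0 <= t ->
        (forall j, 0 <= p t i j) /\ \sum_(j < N) p t i j = 1 &
      forall i j, h^-1 * (p h i j - (1%:M : 'M[R]_N) i j) @[h --> 0^'+]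
        --> Gamma i j].

(* Right-continuous chain, Markov relative to F, with generator Gamma; the
   initial law is arbitrary. *)
Definition markov_chain (N : nat) (Gamma : 'M[R]_N) (r : R -> Omega -> 'I_N)
    : Prop :=
  [/\ forall (t : R) i, 0 <= t -> F t (r t @^-1` [set i]),
      {ae P, forall om, forall t : R, 0 <= t ->
        \forall s \near t^'+, r s om = r t om} &
      exists2 p, transition_function Gamma p &
        forall (s t : R) A i j, 0 <= s -> s <= t -> F s A ->
          P (A `&` r s @^-1` [set i] `&` r t @^-1` [set j]) =
          (P (A `&` r s @^-1` [set i]) * (p (t - s) i j)%:E)%E].

Definition sigma_brownian (m : nat) (w : R -> Omega -> 'cV[R]_m)
    : set (set Omega) :=
  <<s [set A | exists (t : R) k (B : set R),
         [/\ 0 <= t, measurable B & A = [set om | B (w t om k 0)]]] >>.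

Definition sigma_chain (N : nat) (r : R -> Omega -> 'I_N) : set (set Omega) :=
  <<s [set A | exists (t : R) i, 0 <= t /\ A = r t @^-1` [set i]] >>.

Definition independent_sigma (G H : set (set Omega)) : Prop :=
  forall A B, G A -> H B -> P (A `&` B) = (P A * P B)%E.

Definition cvg_in_prob0 (X : nat -> Omega -> \bar R) : Prop :=
  forall e : R, 0 < e ->
    P [set om | (e%:E < X k om)%E] @[k --> \oo] --> 0%E.

(* The elementary process sum_j eta_j 1_{]a_j, b_j]}. *)
Record elementary := Elementary {
  el_size : nat ;
  el_lo : 'I_el_size -> R ;
  el_hi : 'I_el_size -> R ;
  el_val : 'I_el_size -> Omega -> R }.

Definition elementary_predictable (t0 : R) (h : elementary) : Prop :=
  forall j, [/\ t0 <= el_lo j, el_lo j <= el_hi j,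
    meas_wrt (F (el_lo j)) (@el_val h j) &
    exists M, forall om, `|el_val j om| <= M].

Definition el_process (h : elementary) (s : R) (om : Omega) : R :=
  \sum_(j < el_size h) el_val j om * ((el_lo j < s <= el_hi j)%R)%:R.

Definition el_integral (h : elementary) (B : R -> Omega -> R) (t : R)
    (om : Omega) : R :=
  \sum_(j < el_size h) el_val j om *
    (B (Num.min t (el_hi j)) om - B (Num.min t (el_lo j)) om).

(* I is (a version of) the Ito integral of H over [t0, t] with respect to the
   scalar Brownian motion B, i.e. the limit in probability of the integrals of
   elementary processes h_k such that int_t0^t |h_k - H|^2 ds -> 0 in
   probability. *)
Definition is_ito_integral (t0 t : R) (H B : R -> Omega -> R) (I : Omega -> R)
    : Prop :=
  exists h : nat -> elementary,
    [/\ forall k, elementary_predictable t0 (h k),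
        cvg_in_prob0 (fun k om => \int[lebesgue_measure]_(s in `[t0, t])
                        ((el_process (h k) s om - H s om) ^+ 2)%:E)%E &
        cvg_in_prob0 (fun k om => `|el_integral (h k) B t om - I om|%:E)].

(* Z is a version of the conditional expectation E{Y | G}. *)
Definition is_cond_expectation (G : set (set Omega)) (Y Z : Omega -> R)
    : Prop :=
  [/\ P.-integrable setT (EFin \o Y),
      P.-integrable setT (EFin \o Z),
      meas_wrt G Z &
      forall A, G A ->
        (\int[P]_(om in A) (Z om)%:E = \int[P]_(om in A) (Y om)%:E)%E].

End StochasticBasis.

Section SFDE.
Context {R : realType} {d : measure_display} {Omega : measurableType d}.
Context {n m l N : nat} {tau : R}.
Variable P : probability Omega R.
Variable F : R -> set (set Omega).
Variable w : R -> Omega -> 'cV[R]_m.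
Variable r : R -> Omega -> 'I_N.
Variable f : R -> hist n tau -> 'I_N -> 'cV[R]_l -> 'cV[R]_n.
Variable g : R -> hist n tau -> 'I_N -> 'cV[R]_l -> 'M[R]_(n, m).
Variable u : R -> 'cV[R]_l.

Definition initial_condition (t0 : R) (xi : Omega -> hist n tau) : Prop :=
  meas_wrt (F t0) xi /\ exists M, forall om, hnorm (xi om) <= M.

(* x solves dx = f(t, x_t, r, u) dt + g(t, x_t, r, u) dw on [t0, +oo[ with
   x_t0 = xi; x is indexed by R but only its values on [t0 - tau, +oo[ matter. *)
Definition is_solution (t0 : R) (xi : Omega -> hist n tau)
    (x : R -> Omega -> 'cV[R]_n) : Prop :=
  [/\ forall om, {within `[t0 - tau, +oo[, continuous (x ^~ om)},
      {ae P, forall om, segment tau (x ^~ om) t0 = xi om},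
      forall (t : R) k, t0 <= t -> meas_wrt (F t) (fun om => x t om k 0),
      {ae P, forall om, forall (t : R) k, t0 <= t ->
        lebesgue_measure.-integrable `[t0, t]
          (fun s => (f s (segment tau (x ^~ om) s) (r s om) (u s) k 0)%:E)} &
      forall t : R, t0 <= t -> exists I : 'I_n -> 'I_m -> Omega -> R,
        (forall k j, is_ito_integral P F t0 t
           (fun s om => g s (segment tau (x ^~ om) s) (r s om) (u s) k j)
           (fun s om => w s om j 0) (I k j)) /\
        {ae P, forall om, forall k, x t om k 0 = x t0 om k 0
           + \int[lebesgue_measure]_(s in `[t0, t])
               f s (segment tau (x ^~ om) s) (r s om) (u s) k 0
           + \sum_(j < m) I k j om}].

(* The coefficients are such that the SFDE has a continuous solution on
   [t0 - tau, +oo[ for all initial data. *)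
Definition globally_solvable : Prop :=
  forall (t0 : R) xi, 0 <= t0 -> initial_condition t0 xi ->
    exists x, is_solution t0 xi x.

Definition sigma_state (x : R -> Omega -> 'cV[R]_n) (t : R)
    : set (set Omega) :=
  <<s [set A | (exists2 B : set (hist n tau), measurable B &
                  A = [set om | B (segment tau (x ^~ om) t)])
            \/ (exists i, A = r t @^-1` [set i])] >>.

(* LV is the infinitesimal operator of V: along every solution,
     LV(t, x_t, r(t)) = lim_{D -> 0+}
        1/D [E{V(t+D, x_{t+D}, r(t+D)) | x_t, r(t)} - V(t, x_t, r(t))].
   Conditional expectations being defined up to null sets, the limit is one of
   random variables; it is taken in L^1, the mode under which the expectation
   of LV is the limit of the expected difference quotients. *)
Definition is_infinitesimal_operator (V LV : R -> hist n tau -> 'I_N -> R)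
    : Prop :=
  (forall (t : R) i, 0 <= t -> measurable_fun setT (LV t ^~ i)) /\
  forall (t0 : R) xi x (t : R), 0 <= t0 -> initial_condition t0 xi ->
    is_solution t0 xi x -> t0 <= t ->
    exists2 C : R -> Omega -> R,
      \forall D \near (0 : R)^'+,
        is_cond_expectation P (sigma_state x t)
          (fun om => V (t + D) (segment tau (x ^~ om) (t + D)) (r (t + D) om))
          (C D) &
      'E_P[fun om => (`|D^-1 * (C D om - V t (segment tau (x ^~ om) t) (r t om))
                        - LV t (segment tau (x ^~ om) t) (r t om)|)%R]%E
        @[D --> (0 : R)^'+] --> 0%E.

Definition pGUAS (p : R) : Prop :=
  exists2 sigma : R -> R -> R, classKL sigma &
    forall (t0 : R) xi x (t : R), 0 <= t0 -> initial_condition t0 xi ->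
      is_solution t0 xi x -> t0 <= t ->
      ('E_P[fun om => (enorm (x t om) `^ p)%R] <=
       (sigma (fine 'E_P[fun om => (hnorm (xi om) `^ p)%R]) (t - t0))%:E)%E.

Definition pGUES (p : R) : Prop :=
  exists alpha beta : R, [/\ 0 < alpha, 0 < beta &
    forall (t0 : R) xi x (t : R), 0 <= t0 -> initial_condition t0 xi ->
      is_solution t0 xi x -> t0 <= t ->
      ('E_P[fun om => (enorm (x t om) `^ p)%R] <=
       (beta * expR (- alpha * (t - t0)))%:E
         * 'E_P[fun om => (hnorm (xi om) `^ p)%R])%E].

End SFDE.

(* Main.v *)
(* Write v(t) = E V(t, x_t, r(t)).  The L^1 form of the infinitesimal operator
   gives v the right derivative E LV(t, x_t, r(t)) at every t >= t0.  Condition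
   (ii) is stated for a frozen regime i, but it holds for every initial datum:
   restarting the equation at time t from x_t cut off outside {r(t) = i, ||x_t||
   <= M} localises it to that event, because the zero solution forces
   LV(t, 0, i) P(r(t) = i) = 0; summing over i and letting M tend to infinity,
   the right derivative of v is at most mu(t) v(t).  The process r has no fixed
   jump times, so V(s_k, x_{s_k}, r(s_k)) tends a.s. to V(t, x_t, r(t)) along some
   s_k increasing to t (Borel-Cantelli), and Fatou's lemma excludes upward jumps
   of v.  Hence v(t) <= v(t0) exp(int_t0^t mu).  Supporting lines of the concave
   alpha2 and of the convex alpha1 turn this into
   alpha1(E|x(t)|^p) <= exp(delta - eps (t - t0)) alpha2(E||xi||^p). *)
Require Import Defs.
From HB Require Import structures.
From mathcomp Require Import all_boot all_order all_algebra.
From mathcomp Require Import all_classical all_reals all_analysis.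
From mathcomp Require Import measurable_realfun ring lra.
Set Implicit Arguments.
Unset Strict Implicit.
Unset Printing Implicit Defensive.
Import Order.TTheory GRing.Theory Num.Theory.
Import numFieldNormedType.Exports.
Local Open Scope classical_set_scope.
Local Open Scope ring_scope.

(** * Comparison functions and a scalar comparison principle *)

Lemma within_ge0_continuousP (R : realType) (a : R -> R) :
  {within `[0, +oo[, continuous a} <->
  (forall x : R, 0 <= x -> forall e : R, 0 < e -> exists2 dlt : R, 0 < dlt &
     forall y, 0 <= y -> `|y - x| < dlt -> `|a y - a x| < e).
Proof.
split=> [/subspace_continuousP ca x x0 e e0|ca].
  have xin : `[0, +oo[%classic x by rewrite /= in_itv/= x0.
  have /cvgrPdist_lt/(_ e e0) := ca x xin.
  rewrite near_withinE => /nbhs_ballP[dlt/= dlt0 H].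
  exists dlt => // y y0 yx; rewrite distrC; apply: H => /=; last by rewrite in_itv/= y0.
  by rewrite /ball/= distrC.
apply/subspace_continuousP => x /=; rewrite in_itv/= andbT => x0.
apply/cvgrPdist_lt => e e0; have [dlt dlt0 H] := ca x x0 e e0.
rewrite near_withinE; apply/nbhs_ballP; exists dlt => //= y yx /=.
by rewrite in_itv/= andbT => y0; rewrite distrC; apply: H => //; rewrite distrC.
Qed.

(** Unboundedness and the intermediate value theorem provide preimages; strict monotonicity of [a]
    makes the chosen preimage increasing and continuous. Values of [b] at negative arguments are
    arbitrary. *)
Lemma classKoo_inverse (R : realType) (a : R -> R) : classKoo a ->
  exists b : R -> R, classK b /\ (forall s, 0 <= s -> 0 <= b s /\ a (b s) = s).
Proof.
move=> [[ca ia a0] aoo].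
have ia' x y : 0 <= x -> x < y -> a x < a y.
  by move=> x0 xy; apply: ia => //; rewrite in_itv/= andbT// (le_trans x0)// ltW.
have sur s : exists x : R, 0 <= s -> 0 <= x /\ a x = s.
  have [s0|] := boolP (0 <= s); last by exists 0.
  have [x [x0 sx]] : exists x, 0 < x /\ s <= a x.
    near (pinfty_nbhs R) => x; exists x; split; first by near: x; exact: nbhs_pinfty_gt.
    by near: x; move/cvgryPge : aoo => /(_ s).
  have cax : {within `[0, x], continuous a}.
    by apply: continuous_subspaceW ca => y /=; rewrite !in_itv/= => /andP[->].
  have [|c /[!in_itv]/= /andP[c0 _] <-] := IVT (ltW x0) cax (v := s).
    rewrite a0; have ax0 : 0 < a x by rewrite -a0 ia'.
    by rewrite min_l ?max_r ?s0 ?sx// ltW.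
  by exists c.
have [b bP] := choice sur.
have bmono s1 s2 : 0 <= s1 -> 0 <= s2 -> s1 < s2 -> b s1 < b s2.
  move=> s10 s20; have [b10 b1] := bP _ s10; have [b20 b2] := bP _ s20.
  move=> s12; rewrite ltNge; apply/negP; rewrite le_eqVlt => /predU1P[bb|bb].
    by move: s12; rewrite -b1 -b2 bb ltxx.
  by have := ia' _ _ b20 bb; rewrite b1 b2 ltNge (ltW s12).
exists b; split=> //; split.
- apply/within_ge0_continuousP => x x0 e e0; have [bx0 abx] := bP _ x0.
  have up : x < a (b x + e) by rewrite -{1}abx ia'// ltrDl.
  (* If [e <= b x], the point [b x - e] is in the domain where [a] increases and yields a lower
     bound on [b y]; otherwise [b x - e < 0 <= b y] already. *)
  have [lo|lo] := leP e (b x).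
    have dn : a (b x - e) < x by rewrite -{2}abx ia'// ?subr_ge0// ltrBlDr ltrDl.
    exists (Num.min (a (b x + e) - x) (x - a (b x - e))).
      by rewrite lt_min !subr_gt0 up.
    move=> y y0; have [by0 aby] := bP _ y0.
    rewrite lt_min => /andP[/ltr_normlP[_ yu] /ltr_normlP[yl _]].
    have bu : b y < b x + e.
      rewrite ltNge; apply/negP; rewrite le_eqVlt => /predU1P[E|/ia' H].
        by move: yu; rewrite E aby; lra.
      by have := H (addr_ge0 bx0 (ltW e0)); rewrite aby; lra.
    have bl : b x - e < b y.
      rewrite ltNge; apply/negP; rewrite le_eqVlt => /predU1P[E|/ia' H].
        by move: yl; rewrite -E aby; lra.
      by have := H by0; rewrite aby; lra.
    by rewrite ltr_norml; lra.
  exists (a (b x + e) - x); first by rewrite subr_gt0.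
  move=> y y0; have [by0 aby] := bP _ y0.
  move=> /ltr_normlP[_ yu].
  have bu : b y < b x + e.
    rewrite ltNge; apply/negP; rewrite le_eqVlt => /predU1P[E|/ia' H].
      by move: yu; rewrite E aby; lra.
    by have := H (addr_ge0 bx0 (ltW e0)); rewrite aby; lra.
  by rewrite ltr_norml; lra.
- by move=> x y /[!in_itv]/= /[!andbT]; exact: bmono.
- have [b00 ab0] := bP 0 (lexx _); apply/eqP; rewrite eq_le b00 andbT leNgt.
  by apply/negP => /ia'-/(_ (lexx _)); rewrite ab0 a0 ltxx.
Unshelve. all: by end_near. Qed.

(** The slope [c] is the supremum of the slopes of chords ending at [y] from the left; convexity
    bounds these by every chord slope to the right. The chord from [0] is one of them, whence the
    lower bound on [c] that later gives its sign. *)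
Lemma convex_function_supporting_line (R : realType) (a : R -> R) (y : R) :
  convex_function (`[0, +oo[%classic : set R) a -> 0 < y ->
  exists2 c, (a y - a 0) / y <= c & forall s, 0 <= s -> a y + c * (s - y) <= a s.
Proof.
move=> cvxa y0.
have slopes x z : 0 <= x -> x < y -> y < z ->
    (a y - a x) / (y - x) <= (a z - a y) / (z - y).
  move=> x0 xy yz; have zx0 : 0 < z - x by lra.
  have t0 : 0 <= (z - y) / (z - x) by apply: divr_ge0; lra.
  have t1 : (z - y) / (z - x) <= 1 by rewrite ler_pdivrMr//; lra.
  (* The weight [t] is the one for which [t * x + (1 - t) * z = y]. *)
  pose t : {i01 R} := Itv01 t0 t1.
  have /= := cvxa t x z.
  rewrite !inE/= !in_itv/= !andbT => /(_ x0 (le_trans x0 (ltW (lt_trans xy yz)))).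
  rewrite !convRE /=.
  set q := (X in a X <= _); have -> : q = y.
    rewrite -[LHS]/((z - y) / (z - x) * x + (1 - (z - y) / (z - x)) * z).
    by field; rewrite gt_eqF.
  rewrite /unstable.onem.
  rewrite (_ : _ * a x + _ * a z = ((z - y) * a x + (y - x) * a z) / (z - x)); last first.
    by field; rewrite gt_eqF.
  rewrite ler_pdivlMr// => H.
  by rewrite ler_pdivrMr ?subr_gt0// mulrAC ler_pdivlMr ?subr_gt0//; lra.
pose S := [set (a y - a x) / (y - x) | x in [set x | 0 <= x < y]].
have S0 : S ((a y - a 0) / y) by exists 0 => /=; rewrite ?lexx ?subr0.
have ubS z : y < z -> ubound S ((a z - a y) / (z - y)).
  by move=> yz _ [x /= /andP[x0 xy] <-]; exact: slopes.
have hsS : has_sup S.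
  split; first by eexists; exact: S0.
  by eexists; apply: (ubS (y + 1)); lra.
exists (sup S); first exact: sup_upper_bound.
move=> s s0; have [sy|ys|<-] := ltgtP s y.
- have : (a y - a s) / (y - s) <= sup S.
    by apply: sup_upper_bound => //; exists s => //=; rewrite s0 sy.
  by rewrite ler_pdivrMr ?subr_gt0//; lra.
- have : sup S <= (a s - a y) / (s - y) by apply: ge_sup; [case: hsS|exact: ubS].
  by rewrite ler_pdivlMr ?subr_gt0//; lra.
- by lra.
Qed.

Lemma classVKoo_supporting_line (R : realType) (a : R -> R) (y : R) :
  classVKoo a -> 0 < y ->
  exists2 c, 0 < c & forall s, 0 <= s -> a y + c * (s - y) <= a s.
Proof.
move=> [[[_ ia a0] _] cvxa] y0.
have [c ac H] := convex_function_supporting_line cvxa y0.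
exists c => //; apply: lt_le_trans ac; rewrite a0 subr0 divr_gt0// -a0.
by apply: ia; rewrite // in_itv/= andbT// ltW.
Qed.

(** The supporting line of the convex function [- a], with its slope negated; the slope is
    nonnegative because [a] increases from [y] to [y + 1]. *)
Lemma classCKoo_supporting_line (R : realType) (a : R -> R) (y : R) :
  classCKoo a -> 0 < y ->
  exists2 c, 0 <= c & forall s, 0 <= s -> a s <= a y + c * (s - y).
Proof.
move=> [[[_ ia a0] _] cvxa] y0.
have [c _ H] := convex_function_supporting_line cvxa y0.
exists (- c) => [|s /H]; last by lra.
have : a y < a (y + 1) by apply: ia; rewrite ?in_itv/= ?andbT; lra.
by have := H (y + 1); lra.
Qed.

Lemma classK_ge0 (R : realType) (a : R -> R) s : classK a -> 0 <= s -> 0 <= a s.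
Proof.
move=> [_ ia a0]; rewrite le_eqVlt => /predU1P[<-|s0]; first by rewrite a0.
by rewrite -a0 ltW// ia// in_itv/= ?lexx// ltW.
Qed.

Lemma classK_le (R : realType) (a : R -> R) s t : classK a -> 0 <= s -> s <= t ->
  a s <= a t.
Proof.
move=> [_ ia _] s0; rewrite le_eqVlt => /predU1P[->//|st].
by rewrite ltW// ia// in_itv/= andbT// (le_trans s0)// ltW.
Qed.

(** This is the shape of the bound obtained for the $p$th moment, with [a] the upper comparison
    function and [b] the inverse of the lower one. *)
Lemma classKL_exponential (R : realType) (a b : R -> R) (eps delta : R) :
  classK a -> classK b -> 0 < eps ->
  classKL (fun s t => b (expR (delta - eps * t) * a s)).
Proof.
move=> Ka Kb eps0; have [ca ia a0] := Ka; have [cb ib b0] := Kb.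
have ge0 t s : 0 <= s -> 0 <= expR (delta - eps * t) * a s.
  by move=> s0; rewrite mulr_ge0 ?expR_ge0// classK_ge0.
split=> [t _|s s0]; split.
- apply/within_ge0_continuousP => x x0 e e0.
  have [d1 d10 H1] := (within_ge0_continuousP b).1 cb _ (ge0 t x x0) e e0.
  have dE : 0 < d1 / expR (delta - eps * t) by rewrite divr_gt0// expR_gt0.
  have [d2 d20 H2] := (within_ge0_continuousP a).1 ca x x0 _ dE.
  exists d2 => // y y0 yx; apply: H1; first exact: ge0.
  rewrite -mulrBr normrM (gtr0_norm (expR_gt0 _)) mulrC -ltr_pdivlMr ?expR_gt0//.
  exact: H2.
- move=> x y x0 y0 xy; apply: ib.
  + by rewrite in_itv/= ge0//; move: x0; rewrite in_itv/= andbT.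
  + by rewrite in_itv/= ge0//; move: y0; rewrite in_itv/= andbT.
  + by rewrite ltr_pM2l ?expR_gt0// ia.
- by rewrite a0 mulr0.
- move=> t1 t2 _ _ t12; apply: classK_le => //; first exact: ge0.
  apply: ler_wpM2r; first exact: classK_ge0.
  by rewrite ler_expR lerB// ler_pM2l.
- apply/cvgrPdist_lt => e e0.
  have [d d0 H] := (within_ge0_continuousP b).1 cb 0 (lexx _) e e0.
  near=> t; rewrite distrC -[X in _ - X]b0; apply: H; first exact: ge0.
  rewrite subr0 ger0_norm ?ge0// -[delta - _]opprB expRN mulrC ltr_pdivrMr ?expR_gt0//.
  (* The inequality $e^u \ge 1 + u$ replaces the exponential by an affine function of [t], which
     gives an explicit threshold for [t]. *)
  apply: (@lt_le_trans _ _ (d * (1 + (eps * t - delta)))); last first.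
    by rewrite ler_pM2l// expR_ge1Dx.
  rewrite -ltr_pdivrMl//.
  have : (d^-1 * a s - 1 + delta) / eps < t by near: t; apply: nbhs_pinfty_gt; exact: num_real.
  by rewrite ltr_pdivrMr//; lra.
Unshelve. all: by end_near. Qed.

(** Continuous induction: at the supremum [T] of the times up to which [z] stays below [c], the left
    condition gives [z T <= c], and the right condition then carries the bound strictly past [T]. *)
Lemma le_initial_value (R : realType) (t0 c : R) (z : R -> R) : z t0 <= c ->
  (forall t, t0 <= t -> \forall D \near 0^'+, z (t + D) <= z t) ->
  (forall t, t0 < t -> (forall s, t0 <= s < t -> z s <= c) -> z t <= c) ->
  forall t, t0 <= t -> z t <= c.
Proof.
move=> zt0 right left t1 t01; rewrite leNgt; apply/negP => zt1.
pose S := [set s | t0 <= s <= t1 /\ forall u, t0 <= u <= s -> z u <= c].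
have St0 : S t0.
  by split=> [|u]; [rewrite lexx|rewrite -eq_le => /eqP <-].
have hsS : has_sup S.
  by split; [exists t0|exists t1 => s [/andP[]]].
pose T := sup S.
have t0T : t0 <= T by exact: sup_upper_bound.
have Tt1 : T <= t1 by apply: ge_sup; [case: hsS|move=> s [/andP[]]].
have below s : t0 <= s < T -> z s <= c.
  move=> /andP[t0s sT].
  have Ts0 : 0 < T - s by rewrite subr_gt0.
  have [x [_ Hx] sx] := sup_adherent Ts0 hsS.
  apply: Hx; rewrite t0s ltW//; move: sx; rewrite -/T; lra.
have zT : z T <= c.
  by move: t0T; rewrite le_eqVlt => /predU1P[<-//|t0T]; exact: left.
have T1 : T < t1 by rewrite lt_neqAle Tt1 andbT; apply: contraTneq zt1 => <-; rewrite -leNgt.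
have [e /= e0 He] := right _ t0T.
pose D := Num.min (e / 2) (t1 - T).
have D0 : 0 < D by rewrite lt_min divr_gt0// subr_gt0.
have De : D < e by rewrite gt_min; apply/orP; left; lra.
have Dt : T + D <= t1 by rewrite -lerBrDl ge_min lexx orbT.
suff : S (T + D) by move=> /(sup_upper_bound hsS); rewrite -/T; lra.
split=> [|u /andP[t0u uTD]]; first by rewrite Dt andbT; lra.
have [uT|Tu|->//] := ltgtP u T; first by apply: below; rewrite t0u.
rewrite (le_trans _ zT)// -[u](subrKC T) He//=; last by lra.
by rewrite /ball/= sub0r normrN gtr0_norm; lra.
Qed.

Lemma within_ge0_antiderivative (R : realType) (mu : R -> R) (t0 : R) : 0 <= t0 ->
  {within `[0, +oo[, continuous mu} ->
  exists G : R -> R, forall t, t0 <= t -> is_derive t 1 G (mu t) /\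
    \int[lebesgue_measure]_(s in `[t0, t]) mu s = G t - G t0.
Proof.
(* The constant extension of [mu] to negative times is continuous on the whole line, so the case
   [t0 = 0] needs no separate treatment. *)
move=> t00 cmu; pose nu s := mu (Num.max s 0).
have cnu : continuous nu.
  move=> s; apply/cvgrPdist_lt => e e0.
  have [|dlt dlt0 H] := (within_ge0_continuousP mu).1 cmu (Num.max s 0) _ e e0.
    by rewrite le_max lexx orbT.
  near=> y; rewrite distrC; apply: H; first by rewrite le_max lexx orbT.
  have : `|y - s| < dlt by near: y; apply: cvgr_distC_lt; [exact: cvg_id|].
  by rewrite !ltr_norml /Num.max; case: ifPn; case: ifPn; lra.
have inu a b : lebesgue_measure.-integrable `[a, b] (EFin \o nu).
  apply: continuous_compact_integrable; first exact: segment_compact.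
  exact: continuous_subspaceT.
have nuE s : 0 <= s -> nu s = mu s by move=> s0; rewrite /nu max_l.
(* Starting the integral at [t0 - 1] makes [t0] an interior point, where [G] has a two-sided
   derivative. *)
pose G t := \int[lebesgue_measure]_(s in `[t0 - 1, t]) nu s.
exists G => t t0t; split.
  have [|||dG G'] := @continuous_FTC1_closed R nu (t0 - 1) t (t + 1) _ _ _ (cnu t).
  - by rewrite ltrDl.
  - exact: inu.
  - lra.
  by rewrite -(nuE _ (le_trans t00 t0t)) -G' derive1E; exact: DeriveDef.
rewrite /G (@Rintegral_itvB _ _ (BLeft (t0 - 1)) (BRight t)); last 3 first.
- exact: inu.
- by rewrite bnd_simp; lra.
- by rewrite bnd_simp.
rewrite Rintegral_itv_obnd_cbnd; last first.
  by apply: integrableS (inu t0 t) => //; apply: subset_itvr; rewrite bnd_simp.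
apply: eq_Rintegral => s /[!inE]/= /[!in_itv]/= /andP[t0s _].
by rewrite nuE// (le_trans t00).
Unshelve. all: by end_near. Qed.

(* Since [v] need not be continuous, the Dini derivative alone does not control
   [v]; the last hypothesis forbids upward jumps. *)
Lemma linear_comparison (R : realType) (mu v l : R -> R) (t0 : R) : 0 <= t0 ->
  {within `[0, +oo[, continuous mu} ->
  (forall t, t0 <= t -> 0 <= v t) ->
  (forall t, t0 <= t -> D^-1 * (v (t + D) - v t) @[D --> 0^'+] --> l t) ->
  (forall t, t0 <= t -> l t <= mu t * v t) ->
  (forall t, t0 < t -> forall eta dlt : R, 0 < eta -> 0 < dlt ->
     exists s, [/\ t0 <= s, s < t, t - dlt < s & v t <= v s + eta]) ->
  forall t, t0 <= t ->
    v t <= v t0 * expR (\int[lebesgue_measure]_(s in `[t0, t]) mu s).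
Proof.
move=> t00 cmu v0 dv lv jump t t0t.
have [G HG] := within_ge0_antiderivative t00 cmu.
rewrite (HG _ t0t).2 -ler_pdivrMr ?expR_gt0// -expRN.
(* The integrating factor: the right derivative of [v * E] is [(l - mu * v) * E], hence
   nonpositive. *)
pose E s := expR (- (G s - G t0)).
have E0 s : 0 < E s by exact: expR_gt0.
have dE s : t0 <= s -> is_derive s 1 E (- mu s * E s).
  move=> /HG[dG _]; rewrite [X in is_derive _ _ _ X]mulrC.
  rewrite [- mu s](_ : _ = - (mu s - 0)); last by rewrite subr0.
  rewrite /E; exact: is_derive1_comp.
have cE s : t0 <= s -> {for s, continuous E}.
  by move=> /dE[dEs _]; exact/differentiable_continuous/derivable1_diffP.
have rE s : t0 <= s -> D^-1 * (E (s + D) - E s) @[D --> 0^'+] --> - mu s * E s.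
  move=> /dE dEs; rewrite -(@derive_val _ _ _ _ _ _ _ dEs).
  under eq_cvg => D.
    rewrite (_ : _ * _ = D^-1 *: ((E \o shift s) (D *: 1) - E s)); last first.
      by rewrite /= [_%:A]mulr1 [D + s]addrC.
    over.
  exact/cvg_dnbhs_at_right/(@ex_derive _ _ _ _ _ _ _ dEs).
have cEr s : t0 <= s -> E (s + D) @[D --> 0^'+] --> E s.
  move=> /cE Es; apply: (@cvg_at_right_filter _ _ (fun D => E (s + D)) 0).
  have sD : s + D @[D --> (0 : R)] --> s + 0.
    by apply: cvgD; [exact: cvg_cst|exact: cvg_id].
  by rewrite addr0 in sD; apply: (cvg_comp _ _ sD Es).
rewrite -/(E t); apply/ler_addgt0Pr => eps eps0.
pose e := eps / (t - t0 + 1).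
have tt0 : 0 < t - t0 + 1 by lra.
(* Subtracting the slope [e] makes the right derivative of [z] strictly negative, so that [z] lies
   below [z s] just to the right of [s]. The total slack is at most [eps]; the [+ 1] in [e] covers
   [t = t0]. *)
have e0 : 0 < e by rewrite divr_gt0.
pose z s := v s * E s - e * (s - t0).
suff : z t <= v t0.
  rewrite /z; have : e * (t - t0) <= eps; last by lra.
  by rewrite /e mulrAC ler_pdivrMr//; nra.
apply: (@le_initial_value R t0) => //.
- by rewrite /z subrr mulr0 subr0 /E subrr oppr0 expR0 mulr1.
- move=> s t0s.
  have : D^-1 * (v (s + D) - v s) * E (s + D) + v s * (D^-1 * (E (s + D) - E s))
      @[D --> 0^'+] --> l s * E s + v s * (- mu s * E s).
    apply: cvgD; first by apply: cvgM; [exact: dv|exact: cEr].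
    by apply: cvgMr; exact: rE.
  move=> /cvgr_lt/(_ e).
  have le0 : l s * E s + v s * (- mu s * E s) <= 0.
    by rewrite (_ : _ + _ = (l s - mu s * v s) * E s); [rewrite pmulr_lle0// subr_le0 lv|ring].
  move=> /(_ (le_lt_trans le0 e0)); apply: filter_app; near=> D => H.
  have D0 : 0 < D by near: D; exact: nbhs_right_gt.
  have : D * (D^-1 * (v (s + D) - v s) * E (s + D) + v s * (D^-1 * (E (s + D) - E s))) <= D * e.
    by rewrite ler_pM2l// ltW.
  rewrite (_ : D * _ = v (s + D) * E (s + D) - v s * E s) /z; first by lra.
  by field; rewrite gt_eqF.
(* The bound [z s' <= v t0] means [v s' <= q s']. As [q] is continuous, the no-jump hypothesis
   transfers this bound from times slightly before [s] to [s] itself. *)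
- move=> s t0s below; pose q s' := (v t0 + e * (s' - t0)) / E s'.
  have cq : {for s, continuous q}.
    apply: cvgM; last by apply: cvgV; [rewrite gt_eqF|exact/cE/ltW].
    apply: cvgD; first exact: cvg_cst.
    by apply: cvgMr; apply: cvgB; [exact: cvg_id|exact: cvg_cst].
  suff : v s <= q s by rewrite /q /z ler_pdivlMr//; lra.
  apply/ler_addgt0Pr => k k0; have k2 : 0 < k / 2 by rewrite divr_gt0.
  have /cvgrPdist_lt/(_ _ k2)/nbhs_ballP[dlt/= dlt0 Hq] := cq.
  have [s' [t0s' s's sd vs]] := jump s t0s _ _ k2 dlt0.
  have := below s'; rewrite t0s' s's => /(_ isT).
  rewrite /z lerBlDr -ler_pdivlMr// -/(q s') => vs'.
  have : `|q s - q s'| < k / 2.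
    by apply: Hq; rewrite /ball/= gtr0_norm ?subr_gt0//; lra.
  by move=> /ltr_normlP[]; lra.
Unshelve. all: by end_near. Qed.

(** * The history space *)

Lemma enorm_ge0 (R : realType) (n : nat) (v : 'cV[R]_n) : 0 <= enorm v.
Proof. exact: sqrtr_ge0. Qed.

Lemma enorm0 (R : realType) (n : nat) : enorm (0 : 'cV[R]_n) = 0.
Proof. by rewrite /enorm big1 ?sqrtr0// => k _; rewrite mxE expr0n. Qed.

Lemma continuous_enorm (R : realType) (n : nat) : continuous (@enorm R n).
Proof.
have csum : continuous (fun v : 'cV[R]_n => \sum_(k < n) v k 0 ^+ 2).
  apply: continuous_big => [|k _ v]; first exact: add_continuous.
  apply: (@continuous_comp _ _ _ (fun v : 'cV[R]_n => v k 0) (fun c => c ^+ 2)).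
    exact: coord_continuous.
  exact: exprn_continuous.
by move=> v; apply: continuous_comp (csum v) _; exact: sqrt_continuous.
Qed.

Lemma clamp_itv (R : realType) (tau theta : R) : 0 <= tau ->
  - tau <= clamp tau theta <= 0.
Proof.
by move=> tau0; rewrite /clamp le_max lexx/= ge_max oppr_le0 tau0 ge_min lexx orbT.
Qed.

Lemma clampE (R : realType) (tau theta : R) : - tau <= theta <= 0 ->
  clamp tau theta = theta.
Proof. by move=> /andP[h1 h2]; rewrite /clamp min_l// max_r. Qed.

Lemma hist_eq (R : realType) (n : nat) (tau : R) (phi psi : hist n tau) :
  hist_fun phi =1 hist_fun psi -> phi = psi.
Proof.
case: phi psi => [f cf ef] [g cg eg] /= /funext fg; subst g.
by congr Hist; exact: Prop_irrelevance.
Qed.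

Lemma continuous_within_ge_extend (R : realType) (T : topologicalType) (a : R)
    (x : R -> T) :
  {within `[a, +oo[, continuous x} -> continuous (fun s => x (Num.max a s)).
Proof.
move=> /subspace_continuousP cx s U.
move=> /(cx (Num.max a s)); rewrite /= in_itv/= le_max lexx => /(_ isT) xU.
have cmax : {for s, continuous (Num.max a : R -> R)}.
  by apply: (@continuous_max _ _ (fun=> a) id); [exact: cvg_cst|exact: cvg_id].
have {xU} : \forall u \near s, `[a, +oo[%classic (Num.max a u) -> U (x (Num.max a u)).
  exact: (cmax _ xU).
by apply: (@filterS _ (nbhs s)) => u /=; rewrite in_itv/= le_max lexx; apply.
Qed.

Lemma continuous_clamp (R : realType) (tau : R) : continuous (clamp tau).
Proof.
move=> u; have : {for u, continuous (fun v : R => Num.max (- tau) (Num.min v 0))}; last exact.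
apply: (@continuous_max _ _ (fun=> - tau) (fun v : R => Num.min v 0) u).
  exact: cvg_cst.
by apply: (@continuous_min _ _ id (fun=> 0)); [exact: cvg_id|exact: cvg_cst].
Qed.

(** Continuity of the path from [t0 - tau] on excludes the junk branch of [segment]. *)
Lemma segmentE (R : realType) (n : nat) (tau t0 t : R) (x : R -> 'cV[R]_n) :
  0 <= tau -> {within `[t0 - tau, +oo[, continuous x} -> t0 <= t ->
  forall theta, segment tau x t theta = x (t + clamp tau theta).
Proof.
move=> tau0 cx t0t theta; rewrite /segment; case: pselect => [cxt|[]]; first by [].
have /funext -> : (fun s => x (t + clamp tau s)) =1
    (fun s => x (Num.max (t0 - tau) s)) \o (fun s => t + clamp tau s).
  by move=> s /=; rewrite max_r//; have /andP[] := clamp_itv s tau0; lra.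
move=> s; apply: continuous_comp; last exact: continuous_within_ge_extend.
by apply: cvgD; [exact: cvg_cst|exact: continuous_clamp].
Qed.

(** The increment of the path is jointly continuous in the time and in [theta], and vanishes at time
    [t]; compactness of $[-\tau,0]$ gives one neighbourhood of [t] valid for all [theta]. *)
Lemma segment_cvg (R : realType) (n : nat) (tau t0 t : R) (x : R -> 'cV[R]_n) :
  0 <= tau -> {within `[t0 - tau, +oo[, continuous x} -> t0 <= t ->
  forall e, 0 < e -> exists2 dlt : R, 0 < dlt & forall s, t0 <= s ->
    `|s - t| < dlt -> hdist (segment tau x s) (segment tau x t) < e.
Proof.
move=> tau0 cx t0t e e0.
have [y cy yE] : exists2 y, continuous y & forall s, t0 - tau <= s -> x s = y s.
  exists (fun s => x (Num.max (t0 - tau) s)); first exact: continuous_within_ge_extend.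
  by move=> s h; rewrite max_r.
have e2 : 0 < e / 2 by rewrite divr_gt0.
have /compact_near_coveringP cov := @segment_compact R (- tau) 0.
have near_t : \forall s \near t, `[- tau, 0]%classic `<=`
    (fun theta => enorm (y (s + theta) - y (t + theta)) < e / 2).
  apply: (cov R (nbhs t)) => theta _.
  pose f (z : R * R) := enorm (y (z.2 + z.1) - y (t + z.1)).
  have cf : {for (theta, t), continuous f}.
    apply: continuous_comp; last exact: continuous_enorm.
    apply: cvgB.
      apply: (@continuous_comp _ _ _ (fun z : R * R => z.2 + z.1) y); last exact: cy.
      by apply: cvgD; [exact: cvg_snd|exact: cvg_fst].
    apply: (@continuous_comp _ _ _ (fun z : R * R => t + z.1) y); last exact: cy.
    by apply: cvgD; [exact: cvg_cst|exact: cvg_fst].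
  have f0 : f (theta, t) < e / 2 by rewrite /f/= subrr enorm0.
  exact: (cvgr_lt _ cf _ f0).
have [dlt/= dlt0 H] := (nbhs_ballP _ _).1 near_t.
exists dlt => // s t0s st; have {}H := H s _.
rewrite /hdist; apply: (@le_lt_trans _ _ (e / 2)); last by lra.
apply: ge_sup.
  by eexists; exists 0 => //; rewrite /= in_itv/= oppr_le0 tau0 lexx.
move=> _ [theta + <-]; rewrite /= in_itv/= => th.
have /andP[th1 th2] := th.
have yseg u : t0 <= u -> segment tau x u theta = y (u + theta).
  by move=> t0u; rewrite (segmentE tau0 cx t0u) (clampE th) yE//; lra.
rewrite [X in enorm (X - _)](yseg s t0s) [X in enorm (_ - X)](yseg t t0t).
by apply: ltW; apply: H; rewrite /ball/= ?in_itv/= // distrC.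
Qed.

Lemma measurable_hist_eval (R : realType) (n : nat) (tau theta : R) (k : 'I_n) :
  measurable_fun setT (fun phi : hist n tau => phi theta k 0).
Proof.
move=> _ B mB; rewrite setTI; apply: sub_sigma_algebra.
by exists theta, k, B.
Qed.

Lemma measurable_enorm_eval (R : realType) (n : nat) (tau theta : R) :
  measurable_fun setT (fun phi : hist n tau => enorm (phi theta)).
Proof.
apply: (@measurableT_comp _ _ _ _ _ _ (@Num.sqrt R)).
  apply: continuous_measurable_fun; exact: sqrt_continuous.
apply: measurable_sum => k; apply: measurable_funX; exact: measurable_hist_eval.
Qed.

Lemma hist_has_sup (R : realType) (n : nat) (tau : R) (phi : hist n tau) :
  0 <= tau -> has_sup [set enorm (phi theta) | theta in `[- tau, 0]].
Proof.
move=> tau0; split.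
  by eexists; exists 0 => //; rewrite /= in_itv/= oppr_le0 tau0 lexx.
have ctphi : {within `[- tau, 0], continuous (fun theta => enorm (phi theta))}.
  apply: continuous_subspaceT => theta.
  apply: continuous_comp; [exact: hist_continuous|exact: continuous_enorm].
have [|c _ H] := EVT_max _ ctphi; first by rewrite oppr_le0.
by exists (enorm (phi c)) => _ [theta th <-]; exact: H.
Qed.

Lemma enorm_le_hnorm (R : realType) (n : nat) (tau : R) (phi : hist n tau) theta :
  0 <= tau -> enorm (phi theta) <= hnorm phi.
Proof.
move=> tau0; rewrite -hist_clamp; apply: sup_upper_bound; first exact: hist_has_sup.
by exists (clamp tau theta) => //; rewrite /= in_itv/= clamp_itv.
Qed.

Lemma hnorm_ge0 (R : realType) (n : nat) (tau : R) (phi : hist n tau) :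
  0 <= tau -> 0 <= hnorm phi.
Proof. by move=> tau0; apply: le_trans (enorm_le_hnorm phi 0 tau0); exact: enorm_ge0. Qed.

Lemma hnorm_chist0 (R : realType) (n : nat) (tau : R) :
  0 <= tau -> hnorm (chist 0 : hist n tau) = 0.
Proof.
move=> tau0; apply/eqP; rewrite eq_le hnorm_ge0// andbT.
apply: ge_sup; first by case: (hist_has_sup (chist 0 : hist n tau) tau0).
by move=> _ [theta _ <-] /=; rewrite enorm0.
Qed.

(** Countably many evaluations determine the norm, hence its measurability. The rationals may range
    over the whole line because a history is constant outside $[-\tau,0]$; this also covers
    [tau = 0]. *)
Lemma hnorm_leP (R : realType) (n : nat) (tau M : R) (phi : hist n tau) :
  0 <= tau -> hnorm phi <= M <-> forall q : rat, enorm (phi (ratr q)) <= M.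
Proof.
move=> tau0; split=> [hM q|H]; first by apply: le_trans hM; exact: enorm_le_hnorm.
apply: ge_sup; first by case: (hist_has_sup phi tau0).
move=> _ [theta _ <-]; rewrite leNgt; apply/negP => Mth.
have cphi : {for theta, continuous (fun theta => enorm (phi theta))}.
  apply: continuous_comp; [exact: hist_continuous|exact: continuous_enorm].
have /nbhs_ballP[e/= e0 He] : \forall u \near theta, M < enorm (phi u).
  exact: (cvgr_gt _ cphi _ Mth).
have [q] : exists q : rat, ratr q \in `]theta - e, theta + e[ by apply: rat_in_itvoo; lra.
rewrite in_itv/= => /andP[q1 q2].
have : M < enorm (phi (ratr q)) by apply: He; rewrite /ball/= ltr_norml; lra.
by rewrite ltNge H.
Qed.

Lemma measurable_hnorm (R : realType) (n : nat) (tau : R) : 0 <= tau ->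
  measurable_fun setT (@hnorm R n tau).
Proof.
move=> tau0; apply: (measurability _ (RGenOInfty.measurableE R)) => // _ [_ [M ->] <-].
have E : @hnorm R n tau @^-1` `]M, +oo[ =
    \bigcup_(q : rat) ~` [set phi : hist n tau | enorm (phi (ratr q)) <= M].
  apply/seteqP; split=> phi /=; rewrite in_itv/= andbT.
    rewrite ltNge => /negP Mphi; apply: contrapT => H; apply: Mphi.
    apply/(hnorm_leP _ _ tau0) => q; apply: contrapT => qM; apply: H; by exists q.
  by move=> [q _ /= qM]; rewrite ltNge; apply/negP => /(hnorm_leP _ _ tau0).
rewrite setTI E; apply: bigcupT_measurable_rat => q; apply: measurableC.
rewrite -[X in measurable X](_ : setT `&`
    (fun phi : hist n tau => enorm (phi (ratr q))) @^-1` `]-oo, M] = _).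
  exact: measurable_enorm_eval.
by rewrite setTI; apply/seteqP; split=> phi /=; rewrite in_itv.
Qed.

(** The sets whose preimage lies in [G] form a sigma-algebra, so it is enough to test the generating
    cylinders. *)
Lemma meas_wrt_hist (R : realType) (n : nat) (tau : R) (T : Type)
    (G : set (set T)) (X : T -> hist n tau) : sigma_algebra setT G ->
  (forall theta k (B : set R), measurable B ->
     G [set om | B (X om theta k 0)]) -> meas_wrt G X.
Proof.
move=> [G0 GC GU] gen B; apply: (@smallest_sub _ _ _ [set B | G (X @^-1` B)]).
  split=> /= [|A GA|A GA].
  - by rewrite preimage_set0.
  - by rewrite setTD preimage_setC -setTD; exact: GC.
  - by rewrite preimage_bigcup; exact: GU.
by move=> _ [theta [k [C [mC ->]]]]; exact: gen.
Qed.

(** * Measure-theoretic preliminaries *)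

Section SigmaAlgebraOps.
Context {T : Type} {G : set (set T)} (sG : sigma_algebra setT G).

Lemma sigma_algebra_setC A : G A -> G (~` A).
Proof. by case: sG => _ GC _ GA; rewrite -setTD; exact: GC. Qed.

Lemma sigma_algebra_setT : G setT.
Proof. by rewrite -setC0; apply: sigma_algebra_setC; case: sG. Qed.

Lemma sigma_algebra_setU A B : G A -> G B -> G (A `|` B).
Proof.
case: sG => G0 _ GU GA GB; rewrite -bigcup2E; apply: GU => -[//|[//|k]].
exact: G0.
Qed.

Lemma sigma_algebra_setI A B : G A -> G B -> G (A `&` B).
Proof.
move=> GA GB; rewrite -(setCK A) -(setCK B) -setCU.
by apply/sigma_algebra_setC/sigma_algebra_setU; exact: sigma_algebra_setC.
Qed.

End SigmaAlgebraOps.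

Section CompleteMeasure.
Context {d : measure_display} {Omega : measurableType d} {R : realType}.
Variable P : probability Omega R.
Hypothesis cP : measure_is_complete P.

Lemma ae_eq_measurable (f g : Omega -> R) : measurable_fun setT f ->
  {ae P, forall om, f om = g om} -> measurable_fun setT g.
Proof.
move=> mf fg; apply/measurable_EFinP.
apply: (ae_measurable_fun cP (f := EFin \o f)); last exact/measurable_EFinP.
by apply: filterS fg => om /= -> _.
Qed.

(** Off a null set the limit is pointwise and therefore measurable; completeness absorbs the
    modification on the null set. *)
Lemma ae_cvg_measurable (f : (Omega -> R)^nat) (g : Omega -> R) :
  (forall k, measurable_fun setT (f k)) ->
  {ae P, forall om, f k om @[k --> \oo] --> g om} -> measurable_fun setT g.
Proof.
move=> mf [N [mN N0 subN]].
apply: (@ae_eq_measurable (g \_ (~` N))).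
  apply: (measurable_restrictT _ _).1; first exact: measurableC.
  apply: (@measurable_fun_cvg _ _ _ _ f) => [k|om omN].
    exact: measurable_funS (mf k).
  by apply: contrapT => H; apply: omN; exact: subN.
exists N; split => // om /= H; apply: contrapT => omN; apply: H.
by rewrite patchE mem_set.
Qed.

Lemma ae_eq_expectation (f g : Omega -> R) : measurable_fun setT f ->
  {ae P, forall om, f om = g om} -> ('E_P[f] = 'E_P[g])%E.
Proof.
move=> mf fg; rewrite unlock; apply: ae_eq_integral => //.
- exact/measurable_EFinP.
- exact/measurable_EFinP/(ae_eq_measurable mf fg).
- by apply: filterS fg => om /= -> _.
Qed.

End CompleteMeasure.

Section RealIntegrable.
Context {d : measure_display} {T : measurableType d} {R : realType}.
Context (P : probability T R).
Implicit Types f g : T -> R.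

Lemma integrable_realZ (c : R) f : P.-integrable setT (EFin \o f) ->
  P.-integrable setT (EFin \o (fun om => c * f om)).
Proof. by move=> fi; exact: (integrableZl measurableT c fi). Qed.

Lemma integrable_realB f g : P.-integrable setT (EFin \o f) ->
  P.-integrable setT (EFin \o g) ->
  P.-integrable setT (EFin \o (fun om => f om - g om)).
Proof. by move=> fi gi; exact: (integrableB measurableT fi gi). Qed.

Lemma integrable_realD f g : P.-integrable setT (EFin \o f) ->
  P.-integrable setT (EFin \o g) ->
  P.-integrable setT (EFin \o (fun om => f om + g om)).
Proof. by move=> fi gi; exact: (integrableD measurableT fi gi). Qed.

Lemma integrable_real_measurable f : P.-integrable setT (EFin \o f) ->
  measurable_fun setT f.
Proof. by move=> /measurable_int/measurable_EFinP. Qed.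

Lemma expectation_integrable f : P.-integrable setT (EFin \o f) ->
  ('E_P[f] = (\int[P]_om f om)%:E)%E.
Proof. by move=> fi; rewrite unlock fineK// integrable_fin_num. Qed.

(* Two increments suffice to recover integrability of [Y] itself. *)
Lemma integrable_difference_quotients (Y Z C1 C2 : T -> R) (a b : R) : a != b ->
  P.-integrable setT (EFin \o C1) -> P.-integrable setT (EFin \o C2) ->
  P.-integrable setT (EFin \o (fun om => a * (C1 om - Y om) - Z om)) ->
  P.-integrable setT (EFin \o (fun om => b * (C2 om - Y om) - Z om)) ->
  P.-integrable setT (EFin \o Y) /\ P.-integrable setT (EFin \o Z).
Proof.
move=> ab iC1 iC2 iH1 iH2.
have ab0 : a - b != 0 by rewrite subr_eq0.
have iY : P.-integrable setT (EFin \o Y).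
  have : P.-integrable setT (EFin \o (fun om => (a - b)^-1 *
      ((a * C1 om - b * C2 om) -
       ((a * (C1 om - Y om) - Z om) - (b * (C2 om - Y om) - Z om))))).
    apply: integrable_realZ; apply: integrable_realB; last exact: integrable_realB.
    by apply: integrable_realB; exact: integrable_realZ.
  congr (P.-integrable _ _); apply/funext => om /=; congr EFin.
  by field.
split=> //.
have : P.-integrable setT (EFin \o (fun om => a * (C1 om - Y om) -
    (a * (C1 om - Y om) - Z om))).
  apply: integrable_realB => //; apply: integrable_realZ; exact: integrable_realB.
congr (P.-integrable _ _); apply/funext => om /=; congr EFin.
by ring.
Qed.

Lemma Rintegral_difference_quotient (Y Z C : T -> R) (a : R) :
  P.-integrable setT (EFin \o Y) -> P.-integrable setT (EFin \o Z) ->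
  P.-integrable setT (EFin \o C) ->
  \int[P]_om (a * (C om - Y om) - Z om) =
  a * (\int[P]_om C om - \int[P]_om Y om) - \int[P]_om Z om.
Proof.
move=> iY iZ iC; rewrite RintegralB//; last first.
  by apply: integrable_realZ; exact: integrable_realB.
by rewrite RintegralZl//; [rewrite RintegralB|exact: integrable_realB].
Qed.

End RealIntegrable.

(** * Jensen-type inequalities from supporting lines *)

Lemma probability_Rintegral_cst (d : measure_display) (T : measurableType d)
    (R : realType) (P : probability T R) (z : R) : \int[P]_om z = z.
Proof.
rewrite (@Rintegral_cst _ _ _ P setT)// -[X in _ * fine X]/(P setT).
by rewrite probability_setT mulr1.
Qed.

(** Jensen's inequality, with [Y] dominated by [a (X om)] so that integrability of the latter is not
    at issue. *)
Lemma le_concave_Rintegral (d : measure_display) (T : measurableType d)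
    (R : realType) (P : probability T R) (a : R -> R) (X Y : T -> R) :
  classCKoo a -> P.-integrable setT (EFin \o X) -> P.-integrable setT (EFin \o Y) ->
  (forall om, 0 <= X om) -> (forall om, Y om <= a (X om)) ->
  \int[P]_om Y om <= a (\int[P]_om X om).
Proof.
move=> Ka iX iY X0 YX.
(* Supporting lines are available only at positive points, so [y] is any positive upper bound of the
   mean; when the mean is zero, [y] is sent to [0] by continuity of [a]. *)
have le_at y : 0 < y -> \int[P]_om X om <= y -> \int[P]_om Y om <= a y.
  move=> y0 Xy; have [c c0 H] := classCKoo_supporting_line Ka y0.
  have icst (z : R) : P.-integrable setT (EFin \o (fun=> z)).
    exact: finite_measure_integrable_cst.
  have : \int[P]_om Y om <= \int[P]_om (a y + c * (X om - y)).
    apply: le_Rintegral => //.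
      apply: integrable_realD => //; apply: integrable_realZ.
      exact: integrable_realB.
    by move=> om _; exact: le_trans (YX om) (H _ (X0 om)).
  have iB : P.-integrable setT (EFin \o (fun om => X om - y)) by exact: integrable_realB.
  rewrite RintegralD//; last exact: integrable_realZ.
  rewrite RintegralZl// RintegralB// !probability_Rintegral_cst.
  move=> /le_trans; apply; rewrite gerDl; nra.
have EX0 : 0 <= \int[P]_om X om by apply: Rintegral_ge0.
have [EX_gt0|] := ltP 0 (\int[P]_om X om); first exact: le_at.
move=> EX_le0; have -> : \int[P]_om X om = 0 by apply: le_anti; rewrite EX_le0.
case: Ka => -[[ca _ a0] _] _; apply/ler_addgt0Pr => e e0.
have [dlt dlt0 H] := (within_ge0_continuousP a).1 ca 0 (lexx _) e e0.
have d2 : 0 < dlt / 2 by rewrite divr_gt0.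
apply: le_trans (le_at _ d2 (le_trans EX_le0 (ltW d2))) _.
have := H (dlt / 2) (ltW d2); rewrite subr0 gtr0_norm// => /(_ _)/ltr_normlP[|_]; lra.
Qed.

(** Jensen's inequality solved for the mean. Dividing by the positive slope of a supporting line
    dominates [X] by an affine function of [Y], so [X] need not be known integrable in advance and
    the conclusion is stated in the extended reals. *)
Lemma expectation_le_convex (d : measure_display) (T : measurableType d)
    (R : realType) (P : probability T R) (a : R -> R) (X Y : T -> R) (y : R) :
  classVKoo a -> measurable_fun setT X -> P.-integrable setT (EFin \o Y) ->
  (forall om, 0 <= X om) -> (forall om, a (X om) <= Y om) ->
  0 <= y -> \int[P]_om Y om <= a y -> ('E_P[X] <= y%:E)%E.
Proof.
move=> Ka mX iY X0 aXY.
have le_at z : 0 < z -> \int[P]_om Y om <= a z -> ('E_P[X] <= z%:E)%E.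
  move=> z0 Yz; have [c c0 H] := classVKoo_supporting_line Ka z0.
  have icst (u : R) : P.-integrable setT (EFin \o (fun=> u)).
    exact: finite_measure_integrable_cst.
  have iB : P.-integrable setT (EFin \o (fun om => Y om - a z)) by exact: integrable_realB.
  pose W om := c^-1 * (Y om - a z) + z.
  have iW : P.-integrable setT (EFin \o W).
    by apply: integrable_realD => //; exact: integrable_realZ.
  have XW om : X om <= W om.
    rewrite -lerBlDr -(ler_pM2l c0) mulrA divff ?gt_eqF// mul1r.
    have := H _ (X0 om); have := aXY om; lra.
  apply: (@le_trans _ _ 'E_P[W]%E).
    rewrite unlock; apply: ge0_le_integral => //.
    - by move=> om _; rewrite lee_fin.
    - exact/measurable_EFinP.
    - exact: measurable_int iW.
    - by move=> om _; rewrite lee_fin.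
  rewrite expectation_integrable// lee_fin RintegralD//; last exact: integrable_realZ.
  rewrite RintegralZl// RintegralB// !probability_Rintegral_cst.
  by rewrite gerDr pmulr_rle0 ?invr_gt0// subr_le0.
rewrite le_eqVlt => /predU1P[<-|]; last exact: le_at.
case: Ka (Ka) => -[[_ ia a0] _] _ Ka; rewrite a0 => Y_le0.
apply/lee_addgt0Pr => e e0; rewrite add0e; apply: le_at => //.
by apply: le_trans Y_le0 _; rewrite -a0 ltW// ia// in_itv/= ?lexx// ltW.
Qed.

(** * Solutions of the equation *)

Lemma continuous_functional_segment (R : realType) (n N : nat) (tau t0 t : R)
    (V : R -> hist n tau -> 'I_N -> R) (x : R -> 'cV[R]_n) (i : 'I_N) :
  0 <= tau -> 0 <= t0 -> continuous_functional V ->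
  {within `[t0 - tau, +oo[, continuous x} -> t0 <= t ->
  forall e, 0 < e -> exists2 dlt : R, 0 < dlt & forall s, t0 <= s ->
    `|s - t| < dlt -> `|V s (segment tau x s) i - V t (segment tau x t) i| < e.
Proof.
move=> tau0 t00 cV cx t0t e e0.
have [|d1 d10 H1] := cV t (segment tau x t) i _ e e0; first by lra.
have [d2 d20 H2] := segment_cvg tau0 cx t0t d10.
exists (Num.min d1 d2); first by rewrite lt_min d10.
move=> s t0s; rewrite lt_min => /andP[sd1 sd2].
by apply: H1 => //; [lra|exact: H2].
Qed.

(** * Stochastic continuity of the switching process *)

Section MarkovChain.
Context {d : measure_display} {Omega : measurableType d} {R : realType}.
Context (P : probability Omega R) (F : R -> set (set Omega)) (N : nat).
Context (Gamma : 'M[R]_N) (r : R -> Omega -> 'I_N).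
Hypothesis usualF : usual_conditions P F.
Hypothesis chain_r : markov_chain P F Gamma r.

Lemma measurable_chain t i : 0 <= t -> measurable (r t @^-1` [set i]).
Proof.
case: usualF => _ FT _ _ _; case: chain_r => rF _ _ t0.
by apply: (FT _ t0).2; exact: rF.
Qed.

Lemma transition_diag_cvg (p : R -> 'M[R]_N) : transition_function Gamma p ->
  forall e, 0 < e -> exists2 dlt : R, 0 < dlt & forall h i, 0 < h -> h < dlt ->
    1 - p h i i <= e.
Proof.
move=> [_ _ _ gen] e e0.
have near0 : \forall h \near 0^'+, forall i, 1 - p h i i < e.
  apply: filter_forall => i.
  have : - (h * (h^-1 * (p h i i - (1%:M : 'M[R]_N) i i))) @[h --> 0^'+]
      --> - (0 * Gamma i i).
    apply: cvgN; apply: cvgM; last exact: gen.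
    by apply: cvg_at_right_filter; exact: cvg_id.
  rewrite mul0r oppr0 => /cvgr_lt/(_ _ e0); apply: filter_app; near=> h.
  have h0 : 0 < h by near: h; exact: nbhs_right_gt.
  by rewrite mulVKf ?gt_eqF// mxE eqxx opprB.
have [dlt /= dlt0 H] := near0.
exists dlt => // h i h0 hd; apply/ltW/H => //=.
by rewrite /ball/= sub0r normrN gtr0_norm.
Unshelve. all: by end_near. Qed.

(** Splitting by the regime at time [s], the event of leaving [i] has probability
    $P(r(s)=i)\,(1-p_{ii}(t-s))$, which is small because the diagonal of the transition function
    tends to 1 at zero. *)
Lemma chain_no_fixed_jump t e : 0 < e -> exists2 dlt : R, 0 < dlt &
  forall s, 0 <= s -> s < t -> t - s < dlt ->
    (P [set om | r s om != r t om] <= e%:E)%E.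
Proof.
move=> e0; have [rF _ [p pP Hp]] := chain_r.
(* The [N] regimes share the budget [e]; [N.+1] avoids a division by zero. *)
have [|dlt dlt0 H] := transition_diag_cvg pP (e := e / N.+1%:R).
  by rewrite divr_gt0.
exists dlt => // s s0 st sd.
have sF u : 0 <= u -> sigma_algebra setT (F u).
  by case: usualF => _ FT _ _ _ /FT[].
have t0 : 0 <= t by apply: le_trans (ltW st).
pose A k := [set om | nat_of_ord (r s om) = k /\ r s om != r t om].
have AE (i : 'I_N) : A i = r s @^-1` [set i] `\` r t @^-1` [set i].
  apply/seteqP; split=> om /= [].
    by move=> /val_inj <- /eqP rst; split => // rti; exact: rst.
  by move=> <- /eqP; rewrite eq_sym.
have mA (i : 'I_N) : measurable (A i).
  by rewrite AE; apply: measurableD; exact: measurable_chain.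
have -> : [set om | r s om != r t om] = \big[setU/set0]_(i < N) A i.
  apply/seteqP; split=> om; rewrite -bigcup_mkord /=.
    by move=> rst; exists (r s om) => //=; exact: ltn_ord.
  by move=> [k _ []].
apply: (@le_trans _ _ (\sum_(i < N) P (A i))%E).
  by apply: Boole_inequality => k kN; exact: (mA (Ordinal kN)).
apply: (@le_trans _ _ (\sum_(i < N) (e / N.+1%:R)%:E)%E).
  apply: lee_sum => i _; rewrite AE measureD; last first.
  - by rewrite (le_lt_trans (probability_le1 _ _)) ?ltry//; exact: measurable_chain.
  - exact: measurable_chain.
  - exact: measurable_chain.
  have := Hp s t setT i i s0 (ltW st) (sigma_algebra_setT (sF s s0)).
  rewrite setTI => PE.
  rewrite -[X in (X <= _)%E]/(P (r s @^-1` [set i])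
    - P (r s @^-1` [set i] `&` r t @^-1` [set i]))%E PE.
  have [] : (0 <= P (r s @^-1` [set i]) /\ P (r s @^-1` [set i]) <= 1)%E.
    by split => //; apply: probability_le1; exact: measurable_chain.
  have : P (r s @^-1` [set i]) \is a fin_num by rewrite fin_num_measure//; exact: measurable_chain.
  move: (P (r s @^-1` [set i])) => [q _| |]//; rewrite -EFinM -EFinB !lee_fin => q0 q1.
  have := H (t - s) i; rewrite subr_gt0 => /(_ st sd).
  have : 0 <= e / N.+1%:R by rewrite divr_ge0// ltW.
  by set e' := e / _ => e'0 pe; nra.
rewrite sumEFin lee_fin sumr_const card_ord -[X in X <= _]mulr_natr mulrAC.
by rewrite ler_pdivrMr// ler_pM2l// ler_nat.
Qed.

End MarkovChain.

(** * Measurability and right derivative of the expected functional along a solution *)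

Section Solutions.
Context {R : realType} {n m l N : nat} {tau : R}.
Context {d : measure_display} {Omega : measurableType d}.
Context (P : probability Omega R) (F : R -> set (set Omega)).
Context (w : R -> Omega -> 'cV[R]_m) (Gamma : 'M[R]_N) (r : R -> Omega -> 'I_N).
Context (f : R -> hist n tau -> 'I_N -> 'cV[R]_l -> 'cV[R]_n).
Context (g : R -> hist n tau -> 'I_N -> 'cV[R]_l -> 'M[R]_(n, m)).
Context (V LV : R -> hist n tau -> 'I_N -> R).
Hypothesis tau0 : 0 <= tau.
Hypothesis usualF : usual_conditions P F.
Hypothesis chain_r : markov_chain P F Gamma r.
Hypothesis V_cont : continuous_functional V.
Hypothesis LV_op : is_infinitesimal_operator P F w r f g (fun=> 0) V LV.

Local Notation sol := (is_solution P F w r f g (fun=> 0)).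

Let sF t : 0 <= t -> sigma_algebra setT (F t).
Proof. by case: usualF => _ FT _ _ _ /FT[]. Qed.

Let mF t A : 0 <= t -> F t A -> measurable A.
Proof. by case: usualF => _ FT _ _ _ /FT[_]; apply. Qed.

Let Fle s t : 0 <= s -> s <= t -> F s `<=` F t.
Proof. by case: usualF => _ _ Fm _ _; exact: Fm. Qed.

Lemma segment_adapted t0 xi x t : 0 <= t0 -> initial_condition F t0 xi ->
  sol t0 xi x -> t0 <= t -> meas_wrt (F t) (fun om => segment tau (x ^~ om) t).
Proof.
move=> t00 [xiF _] [cx x0 xF _ _] t0t.
have t_ge0 := le_trans t00 t0t.
apply: meas_wrt_hist; first exact: sF.
move=> theta k B mB; pose s := t + clamp tau theta.
have -> : [set om | B (segment tau (x ^~ om) t theta k 0)] = [set om | B (x s om k 0)].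
  by apply/funext => om /=; rewrite (segmentE tau0 (cx om) t0t).
have /andP[cl0 cl1] := clamp_itv theta tau0.
have [t0s|st0] := leP t0 s.
  by apply: (Fle (le_trans t00 t0s)) (xF s k t0s B mB); rewrite /s; lra.
apply: (Fle t00 t0t).
(* Before [t0] the path coincides with [xi] only almost surely, so the event differs from [A'] by a
   null set; null sets belong to [F 0], hence to [F t0]. *)
pose A' := [set om | B (xi om (s - t0) k 0)].
have FA' : F t0 A'.
  have := xiF [set phi : hist n tau | B (phi (s - t0) k 0)]; apply.
  by apply: sub_sigma_algebra; exists (s - t0), k, B.
have F0 : P.-negligible `<=` F t0.
  by case: usualF => _ _ _ _ FN; apply: subset_trans FN _; exact: Fle.
pose E := [set om | segment tau (x ^~ om) t0 = xi om].
have FE : F t0 (~` E) by apply: F0; exact: x0.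
have -> : [set om | B (x s om k 0)] =
    (A' `&` E) `|` ([set om | B (x s om k 0)] `&` ~` E).
  rewrite -[LHS](setIT) -(setUv E) setIUr; congr (_ `|` _).
  apply/seteqP; split=> om [] /= + xiE; rewrite /A' /= -xiE
      (segmentE tau0 (cx om) (lexx t0)) clampE ?subrKC//.
    by move: st0; rewrite /s; lra.
  by move: st0; rewrite /s; lra.
apply: (sigma_algebra_setU (sF t00)).
  apply: (sigma_algebra_setI (sF t00)) => //.
  by rewrite -[E]setCK; exact: (sigma_algebra_setC (sF t00)).
by apply: F0; apply: negligibleS x0; exact: subIsetr.
Qed.

Lemma measurable_segment t0 xi x t : 0 <= t0 -> initial_condition F t0 xi ->
  sol t0 xi x -> t0 <= t ->
  measurable_fun setT (fun om => segment tau (x ^~ om) t).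
Proof.
move=> t00 xiF solx t0t _ B mB; rewrite setTI.
by apply: (@mF t); [exact: (le_trans t00 t0t)|exact: (segment_adapted t00 xiF solx t0t)].
Qed.

Lemma measurable_chain_case t (h : Omega -> 'I_N -> R) : 0 <= t ->
  (forall i, measurable_fun setT (h ^~ i)) ->
  measurable_fun setT (fun om => h om (r t om)).
Proof.
move=> t_ge0 mh _ B mB; rewrite setTI.
have -> : (fun om => h om (r t om)) @^-1` B =
    \bigcup_(i in [set: 'I_N]) (r t @^-1` [set i] `&` (h ^~ i) @^-1` B).
  apply/seteqP; split=> [om Bom|om [i _ [/= <-]]] //.
  by exists (r t om).
apply: fin_bigcup_measurable => [|i _]; first exact: finite_finset.
apply: measurableI; first exact: (measurable_chain usualF chain_r).
by rewrite -[X in measurable X]setTI; exact: mh.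
Qed.

Definition value_along (W : R -> hist n tau -> 'I_N -> R)
    (x : R -> Omega -> 'cV[R]_n) (t : R) (om : Omega) : R :=
  W t (segment tau (x ^~ om) t) (r t om).

(** Once the regime equals [r t om], continuity of [V] in a fixed regime applies. Used with times
    approaching [t] from the right for measurability, and from the left for Fatou's lemma. *)
Lemma value_along_cvg t0 xi x t (s : nat -> R) : 0 <= t0 -> sol t0 xi x ->
  t0 <= t -> (forall k, t0 <= s k) -> s k @[k --> \oo] --> t ->
  {ae P, forall om, \forall k \near \oo, r (s k) om = r t om} ->
  {ae P, forall om, value_along V x (s k) om @[k --> \oo] --> value_along V x t om}.
Proof.
move=> t00 [cx _ _ _ _] t0t t0s st; apply: filterS => om rs.
apply/cvgrPdist_lt => e e0.
have [dlt dlt0 H] := continuous_functional_segment (r t om) tau0 t00 V_cont (cx om) t0t e0.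
move: rs; apply: filter_app; near=> k => rk.
rewrite distrC /value_along rk; apply: H => //.
by rewrite distrC; near: k; move/cvgrPdist_lt : st; apply.
Unshelve. all: by end_near. Qed.

(** The conditional expectations in the infinitesimal operator require integrability of the
    functional at times just after [t]; right-continuity of the path and of the chain makes the
    value at [t] an almost sure limit of these. *)
Lemma measurable_value_along t0 xi x t : 0 <= t0 -> initial_condition F t0 xi ->
  sol t0 xi x -> t0 <= t -> measurable_fun setT (value_along V x t).
Proof.
move=> t00 xiF solx t0t.
have [C [dlt /= dlt0 HC] _] := LV_op.2 t0 xi x t t00 xiF solx t0t.
have dlt2 : 0 < dlt / 2 by rewrite divr_gt0.
pose s k := t + dlt / 2 * harmonic k.
have s0 k : 0 < dlt / 2 * harmonic k by rewrite mulr_gt0// harmonic_gt0.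
have st : s k @[k --> \oo] --> t.
  rewrite -[X in _ --> X]addr0; apply: cvgD; first exact: cvg_cst.
  by rewrite -(mulr0 (dlt / 2)); apply: cvgMr; exact: cvg_harmonic.
have [_ rcont _] := chain_r.
apply: (@ae_cvg_measurable _ _ _ P _ (fun k => value_along V x (s k))).
- by case: usualF.
- move=> k; have [||iY _ _ _] := HC (dlt / 2 * harmonic k); last 1 first.
  - exact: integrable_real_measurable iY.
  - rewrite /ball/= sub0r normrN (gtr0_norm (s0 k)).
    apply: (@le_lt_trans _ _ (dlt / 2)); last by lra.
    by rewrite ger_pMr// /harmonic invf_le1// ler1n.
  - exact: s0.
- apply: (value_along_cvg t00 solx t0t _ st).
    by move=> k; rewrite /s; have := s0 k; lra.
  apply: filterS rcont => om /(_ t (le_trans t00 t0t)) [e /= e0 He].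
  move/cvgrPdist_lt : st => /(_ e e0); apply: filterS => k ke.
  by apply: He => //; rewrite /s; have := s0 k; lra.
Qed.

(** Convergence in $L^1$ entails convergence of means, and testing the conditional expectation on
    the whole space replaces [C D] by the functional at time [t + D]. *)
Lemma right_derivative_value t0 xi x t : 0 <= t0 -> initial_condition F t0 xi ->
  sol t0 xi x -> t0 <= t ->
  [/\ P.-integrable setT (EFin \o value_along V x t),
      P.-integrable setT (EFin \o value_along LV x t) &
      D^-1 * (\int[P]_om value_along V x (t + D) om - \int[P]_om value_along V x t om)
        @[D --> 0^'+] --> \int[P]_om value_along LV x t om].
Proof.
move=> t00 xiF solx t0t.
have [C HC limC] := LV_op.2 t0 xi x t t00 xiF solx t0t.
have mV := measurable_value_along t00 xiF solx t0t.
have mLV : measurable_fun setT (value_along LV x t).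
  apply: (@measurable_chain_case t (fun om i => LV t (segment tau (x ^~ om) t) i)).
    exact: le_trans t0t.
  move=> i; apply: (@measurableT_comp _ _ _ _ _ _ (LV t ^~ i)).
    by apply: LV_op.1; exact: le_trans t0t.
  exact: (measurable_segment t00 xiF solx t0t).
have [fin0 lim0] := (fine_cvgP _ _).1 limC.
pose H D om := D^-1 * (C D om - value_along V x t om) - value_along LV x t om.
have iH : \forall D \near 0^'+, P.-integrable setT (EFin \o C D) /\
    P.-integrable setT (EFin \o H D).
  near=> D.
  have [_ iC _ _] : is_cond_expectation P (sigma_state (tau := tau) r x t)
    (fun om => V (t + D) (segment tau (x ^~ om) (t + D)) (r (t + D) om)) (C D).
    by near: D; exact: HC.
  split=> //; apply/integrableP; split.
    apply/measurable_EFinP; apply: measurable_funB => //.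
    apply: measurable_funM => //; apply: measurable_funB => //.
    exact: integrable_real_measurable iC.
  have : 'E_P[fun om => `|H D om|%R]%E \is a fin_num by near: D; exact: fin0.
  by rewrite unlock ge0_fin_numE//; exact: integral_ge0.
have [e /= e0 He] := iH.
have inear D : 0 < D -> D < e -> P.-integrable setT (EFin \o C D) /\
    P.-integrable setT (EFin \o H D).
  by move=> D0 De; apply: He => //=; rewrite /ball/= sub0r normrN gtr0_norm.
have [iV iLV] : P.-integrable setT (EFin \o value_along V x t) /\
    P.-integrable setT (EFin \o value_along LV x t).
  (* Two distinct increments inside the neighbourhood let the values at [t] be solved for
     linearly. *)
  have [iC1 iH1] : P.-integrable setT (EFin \o C (e / 2)) /\
    P.-integrable setT (EFin \o H (e / 2)) by apply: inear; lra.
  have [iC2 iH2] : P.-integrable setT (EFin \o C (e / 3)) /\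
    P.-integrable setT (EFin \o H (e / 3)) by apply: inear; lra.
  apply: (integrable_difference_quotients _ iC1 iC2 iH1 iH2).
  by rewrite (inj_eq invr_inj); lra.
split=> //; apply/cvgrPdist_lt => eps eps0.
move/cvgr_lt : lim0 => /(_ _ eps0) lim0.
near=> D.
have [iY iC _ EC] : is_cond_expectation P (sigma_state (tau := tau) r x t)
  (fun om => V (t + D) (segment tau (x ^~ om) (t + D)) (r (t + D) om)) (C D).
  by near: D; exact: HC.
have -> : \int[P]_om value_along V x (t + D) om = \int[P]_om C D om.
  rewrite /Rintegral EC//; exact: (sigma_algebra_setT (smallest_sigma_algebra _ _)).
rewrite distrC -(Rintegral_difference_quotient D^-1 iV iLV iC).
have [_ iHD] : P.-integrable setT (EFin \o C D) /\ P.-integrable setT (EFin \o H D).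
  by near: D; exact: iH.
apply: le_lt_trans (le_normr_Rintegral measurableT iHD) _.
have : fine 'E_P[fun om => `|H D om|%R]%E < eps by near: D; exact: lim0.
by rewrite unlock.
Unshelve. all: by end_near. Qed.

(** * Localising condition (ii) to the current regime, and excluding upward jumps *)

Context (mu : R -> R).
Hypothesis f0 : forall (t : R) i, 0 <= t -> f t (chist 0) i 0 = 0.
Hypothesis g0 : forall (t : R) i, 0 <= t -> g t (chist 0) i 0 = 0.
Hypothesis solvable : globally_solvable P F w r f g (fun=> 0).
Hypothesis V_ge0 : forall (t : R) phi i, 0 <= t -> 0 <= V t phi i.
Hypothesis V0 : forall (t : R) i, 0 <= t -> V t (chist 0) i = 0.
Hypothesis cond_ii : forall (t0 : R) xi x (t : R) i, 0 <= t0 -> initial_condition F t0 xi ->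
  sol t0 xi x -> t0 <= t ->
  ('E_P[fun om => LV t (segment tau (x ^~ om) t) i] <=
   (mu t)%:E * 'E_P[fun om => V t (segment tau (x ^~ om) t) i])%E.

Lemma segment_cst t (v : 'cV[R]_n) : segment tau (fun=> v) t = chist v.
Proof.
apply: hist_eq => theta; rewrite (@segmentE _ _ _ t)//.
by apply: continuous_subspaceT => s; exact: cvg_cst.
Qed.

Lemma zero_initial_condition t0 : 0 <= t0 -> initial_condition F t0 (fun=> chist 0 : hist n tau).
Proof.
move=> t00; split; last by exists 0 => _; rewrite hnorm_chist0.
move=> B mB; rewrite preimage_cst; case: ifP => _.
  exact: (sigma_algebra_setT (sF t00)).
by case: (sF t00).
Qed.

Lemma cvg_in_prob0_cst (X : nat -> Omega -> \bar R) :
  (forall k om, X k om = 0%E) -> cvg_in_prob0 P X.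
Proof.
move=> X0 e e0; rewrite (_ : (fun k => P _) = cst 0%E); first exact: cvg_cst.
apply/funext => k; rewrite -(measure0 P); congr (P _); rewrite -subset0 => om /=.
by rewrite X0 lte_fin ltNge (ltW e0).
Qed.

Lemma zero_solution t0 : 0 <= t0 -> sol t0 (fun=> chist 0) (fun _ _ => 0).
Proof.
move=> t00; split.
- by move=> om; apply: continuous_subspaceT => s; exact: cvg_cst.
- by apply: aeW => om; exact: segment_cst.
- move=> t k t0t B mB; rewrite preimage_cst; case: ifP => _.
    exact: (sigma_algebra_setT (sF (le_trans t00 t0t))).
  by case: (sF (le_trans t00 t0t)).
- apply: aeW => om t k t0t.
  apply: (eq_integrable _ (cst 0)) => //; last exact: integrable0.
  move=> s; rewrite inE/= in_itv/= => /andP[t0s _].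
  by rewrite segment_cst f0 ?mxE// (le_trans t00).
- move=> t t0t; exists (fun _ _ _ => 0); split; last first.
    apply: aeW => om k; rewrite mxE big1// addr0 add0r.
    rewrite (@eq_Rintegral _ _ _ _ _ (cst 0)) ?Rintegral_cst ?mul0r//.
    move=> s; rewrite inE/= in_itv/= => /andP[t0s _].
    by rewrite segment_cst f0 ?mxE// (le_trans t00).
  (* The empty sum, of size 0, approximates the zero integrand exactly. *)
  move=> k j; pose h0 : elementary :=
    @Elementary R d Omega 0 (fun=> 0) (fun=> 0) (fun _ _ => 0).
  exists (fun=> h0); split; first by move=> _ [].
    apply: cvg_in_prob0_cst => _ om; apply: integral0_eq => s /=.
    rewrite in_itv/= => /andP[t0s _].
    by rewrite segment_cst g0 ?mxE ?(le_trans t00)// /el_process big_ord0 subr0 expr0n.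
  apply: cvg_in_prob0_cst => _ om.
  by rewrite /el_integral big_ord0 subr0 normr0.
Qed.

(** Along the zero solution, condition (ii) makes every [LV t (chist 0) j] nonpositive, while the
    mean functional is constantly zero, so the mean of the operator vanishes. A term of positive
    weight must then be zero. *)
Lemma operator_zero_history t i : 0 <= t -> P (r t @^-1` [set i]) != 0%E ->
  LV t (chist 0) i = 0.
Proof.
move=> t_ge0 Pi.
have xiF := zero_initial_condition t_ge0; have solx := zero_solution t_ge0.
have LV_le0 j : LV t (chist 0) j <= 0.
  have := cond_ii j t_ge0 xiF solx (lexx t).
  rewrite segment_cst V0// !expectation_cst -EFinM lee_fin mulr0; exact.
have [_ iLV dLV] := right_derivative_value t_ge0 xiF solx (lexx t).
have int0 s : 0 <= s -> \int[P]_om value_along V (fun _ _ => 0) s om = 0.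
  move=> s0; rewrite (@eq_Rintegral _ _ _ _ _ (cst 0)) ?Rintegral_cst ?mul0r//.
  by move=> om _; rewrite /value_along segment_cst V0.
have LV_int : 0 = \int[P]_om value_along LV (fun _ _ => 0) t om.
  apply: cvg_unique dLV => //; apply: cvg_near_cst; near=> D.
  by rewrite !int0 ?subrr ?mulr0// addr_ge0//; near: D; exact: nbhs_right_ge.
pose A := r t @^-1` [set i].
have mA : measurable A := measurable_chain usualF chain_r i t_ge0.
have fA : P A \is a fin_num by rewrite fin_num_measure.
have PA : 0 < fine (P A).
  by rewrite fine_gt0// lt0e Pi measure_ge0/= ltey_eq fA.
apply/eqP; rewrite eq_le LV_le0/=.
rewrite -(pmulr_lge0 _ PA).
have <- : \int[P]_om (LV t (chist 0) i * \1_A om) = LV t (chist 0) i * fine (P A).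
  rewrite RintegralZl//; last exact: integrable_indic.
  by rewrite /Rintegral integral_indic ?setIT.
rewrite [leLHS]LV_int; apply: le_Rintegral => //.
  by apply: integrable_realZ; exact: integrable_indic.
move=> om _; rewrite /value_along segment_cst indicE.
case: (boolP (om \in A)) => [|_]; last by rewrite mulr0.
by rewrite inE /A/= => ->; rewrite mulr1.
Unshelve. all: by end_near. Qed.

(* Restarting the equation at time [t] from the history [x_t] cut off outside
   an event of [F t] turns the bound for frozen [i] into one for [r t]. *)
Lemma restarted_inequality t0 xi x t i (M : R) : 0 <= t0 ->
  initial_condition F t0 xi -> sol t0 xi x -> t0 <= t ->
  forall A, A = r t @^-1` [set i] `&`
                [set om | hnorm (segment tau (x ^~ om) t) <= M] ->
  (\int[P]_om ((value_along LV x t \_ A) om)%:E <=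
   (mu t)%:E * \int[P]_om ((value_along V x t \_ A) om)%:E)%E.
Proof.
move=> t00 xiF solx t0t A defA; have t_ge0 := le_trans t00 t0t.
have FA : F t A.
  rewrite defA; apply: (sigma_algebra_setI (sF t_ge0)); first by case: chain_r => rF _ _; exact: rF.
  have mM : measurable [set phi : hist n tau | hnorm phi <= M].
    rewrite -[X in measurable X](_ : setT `&` @hnorm R n tau @^-1` `]-oo, M] = _).
      exact: measurable_hnorm.
    by rewrite setTI; apply/seteqP; split=> phi /=; rewrite in_itv.
  exact: (segment_adapted t00 xiF solx t0t mM).
have mA : measurable A := mF t_ge0 FA.
(* The operator at the zero history is controlled only for regimes of positive probability; on a
   null event both integrals vanish anyway. *)
have [PA0|PA] := eqVneq (P A) 0%E.
  have [/integrable_real_measurable mV /integrable_real_measurable mLV _] :=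
    right_derivative_value t00 xiF solx t0t.
  have int0 (W : Omega -> R) : measurable_fun setT W ->
      (\int[P]_om ((W \_ A) om)%:E = 0)%E.
    move=> mW; transitivity (\int[P]_(om in A) (EFin \o W) om)%E.
      by rewrite [RHS]integral_mkcond restrict_EFin.
    rewrite null_set_integral//.
    by apply/measurable_EFinP; exact: measurable_funS mW.
  by rewrite !int0 ?mule0.
have Pi : P (r t @^-1` [set i]) != 0%E.
  apply: contra_neq PA => Pi0; apply/eqP; rewrite eq_le measure_ge0 andbT -Pi0.
  apply: le_measure; rewrite ?inE//; last by rewrite defA; exact: subIsetl.
  exact: (measurable_chain usualF chain_r).
have LV0 := operator_zero_history t_ge0 Pi.
(* The cut-off at [M] keeps the restarted datum bounded, as an initial condition must be. *)
pose xi' om := if om \in A then segment tau (x ^~ om) t else chist 0.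
have xiF' : initial_condition F t xi'.
  split; last first.
    exists (Num.max M 0) => om; rewrite /xi'; case: ifPn => [|_].
      by rewrite inE defA => -[_ /= omM]; rewrite le_max omM.
    by rewrite hnorm_chist0// le_max lexx orbT.
  move=> B mB.
  have -> : xi' @^-1` B = (A `&` ((fun om => segment tau (x ^~ om) t) @^-1` B))
      `|` (~` A `&` ((fun=> chist 0) @^-1` B)).
    apply/seteqP; split=> om /=; rewrite /xi'.
      by case: (boolP (om \in A)); [rewrite inE; left|rewrite notin_setE; right].
    by move=> [[omA]|[omA]]; [rewrite mem_set|rewrite memNset].
  apply: (sigma_algebra_setU (sF t_ge0)); apply: (sigma_algebra_setI (sF t_ge0)) => //.
  - exact: (segment_adapted t00 xiF solx t0t mB).
  - exact: (sigma_algebra_setC (sF t_ge0)).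
  - exact: (zero_initial_condition t_ge0).1.
have [x' solx'] := solvable t_ge0 xiF'.
have [_ x't _ _ _] := solx'.
have cP : measure_is_complete P by case: usualF.
have caseE (W : R -> hist n tau -> 'I_N -> R) : W t (chist 0) i = 0 ->
    forall om, W t (xi' om) i = (value_along W x t \_ A) om.
  move=> W0 om; rewrite /xi' patchE; case: ifPn => //.
  by rewrite inE defA => -[/= <- _].
have ELV : ('E_P[fun om => LV t (segment tau (x' ^~ om) t) i] =
    \int[P]_om ((value_along LV x t \_ A) om)%:E)%E.
  rewrite (ae_eq_expectation cP (g := value_along LV x t \_ A)) ?unlock//.
    apply: (@measurableT_comp _ _ _ _ _ _ (LV t ^~ i)).
      by apply: LV_op.1; exact: t_ge0.
    exact: (measurable_segment t_ge0 xiF' solx' (lexx t)).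
  by apply: filterS x't => om ->; exact: caseE.
have EV : ('E_P[fun om => V t (segment tau (x' ^~ om) t) i] =
    \int[P]_om ((value_along V x t \_ A) om)%:E)%E.
  rewrite -(ae_eq_expectation cP (f := value_along V x t \_ A)) ?unlock//.
    apply: (measurable_restrictT _ _).1 => //.
    apply: measurable_funS (measurable_value_along t00 xiF solx t0t) => //.
  by apply: filterS x't => om ->; rewrite caseE// V0.
by rewrite -ELV -EV; exact: (cond_ii i t_ge0 xiF' solx' (lexx t)).
Qed.

(** The localised inequalities are summed over the regimes on the event where the history has norm
    at most [k]; dominated convergence by the absolute value of the difference [Z] removes the
    cut-off. *)
Lemma expected_operator_le t0 xi x t : 0 <= t0 -> initial_condition F t0 xi ->
  sol t0 xi x -> t0 <= t ->
  \int[P]_om value_along LV x t om <= mu t * \int[P]_om value_along V x t om.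
Proof.
move=> t00 xiF solx t0t; have t_ge0 := le_trans t00 t0t.
have [iV iLV _] := right_derivative_value t00 xiF solx t0t.
pose A k i := r t @^-1` [set i] `&`
  [set om | hnorm (segment tau (x ^~ om) t) <= k%:R].
pose Z om := value_along LV x t om - mu t * value_along V x t om.
have iZ : P.-integrable setT (EFin \o Z).
  by apply: integrable_realB => //; exact: integrable_realZ.
pose B k := [set om | hnorm (segment tau (x ^~ om) t) <= k%:R].
have mB k : measurable (B k).
  rewrite -[X in measurable X](_ : setT `&`
    (fun om => hnorm (segment tau (x ^~ om) t)) @^-1` `]-oo, k%:R] = _).
    apply: (@measurableT_comp _ _ _ _ _ _ (@hnorm R n tau)) => //.
      exact: measurable_hnorm.
    exact: (measurable_segment t00 xiF solx t0t).
  by rewrite setTI; apply/seteqP; split=> phi /=; rewrite in_itv.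
have mA k i : measurable (A k i).
  by apply: measurableI; [exact: (measurable_chain usualF chain_r)|exact: mB].
have iA W k i : P.-integrable setT (EFin \o W) ->
    P.-integrable setT (EFin \o (W \_ (A k i))).
  move=> iW; rewrite -restrict_EFin.
  by apply: (integrable_mkcond _ _).1 => //; exact: integrableS iW.
have AB k om : (Z \_ (B k)) om = \sum_(i < N) (Z \_ (A k i)) om.
  rewrite (bigD1 (r t om))//= big1 ?addr0 => [|i ri]; last first.
    by rewrite patchE memNset// => -[/= rti _]; rewrite rti eqxx in ri.
  rewrite !patchE; congr (if _ then _ else _).
  by apply/idP/idP; rewrite !inE; [split|case].
have ZA k i : (\int[P]_om ((Z \_ (A k i)) om)%:E <= 0)%E.
  have -> : (fun om => ((Z \_ (A k i)) om)%:E) =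
      (fun om => ((value_along LV x t \_ (A k i)) om)%:E
                  - ((mu t)%:E * ((value_along V x t \_ (A k i)) om)%:E))%E.
    by apply/funext => om; rewrite !patchE; case: ifP; rewrite ?mule0 ?sube0.
  rewrite integralB//; [|exact: iA|by apply: integrableZl => //; exact: iA].
  rewrite integralZl//; last exact: iA.
  by rewrite sube_le0; exact: (restarted_inequality t00 xiF solx t0t erefl).
have ZB k : (\int[P]_om ((Z \_ (B k)) om)%:E <= 0)%E.
  under eq_integral do rewrite AB -sumEFin.
  rewrite integral_sum// => [|i]; last exact: iA.
  by apply: sume_le0.
have iN : P.-integrable setT (abse \o (EFin \o Z)) by exact: integrable_abse.
have [||||_ _ limZ] := @dominated_convergence _ _ _ P setT measurableT
  (fun k om => ((Z \_ (B k)) om)%:E) (EFin \o Z) (abse \o (EFin \o Z)) _ _ _ iN _.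
- move=> k; apply/measurable_EFinP; apply: (measurable_restrictT _ _).1 => //.
  by apply: measurable_funS (integrable_real_measurable iZ).
- apply/measurable_EFinP; exact: (integrable_real_measurable iZ).
- apply: aeW => om _; apply: cvg_near_cst; near=> k.
  rewrite patchE mem_set//= /B/=.
  by near: k; exact: nbhs_infty_ger.
- apply: aeW => om k _; rewrite patchE; case: ifP => // _.
  by rewrite abse0 lee_fin.
have : (\int[P]_om (Z om)%:E <= 0)%E.
  by rewrite -(cvg_lim _ limZ)//; apply: lime_le; [exact: cvgP limZ|exact: nearW].
rewrite -[X in (X <= _)%E]fineK ?integrable_fin_num// lee_fin -/(Rintegral _ _ _).
rewrite RintegralB//; last exact: integrable_realZ.
by rewrite RintegralZl// subr_le0.
Unshelve. all: by end_near. Qed.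

(** Times are picked so close to [t] that the probabilities of a regime different from [r t] are
    summable; Borel-Cantelli then leaves almost surely finitely many disagreements. *)
Lemma chain_left_sequence (t a : R) : a < t -> 0 <= a ->
  exists s : nat -> R, [/\ forall k, a <= s k < t, s k @[k --> \oo] --> t &
    {ae P, forall om, \forall k \near \oo, r (s k) om = r t om}].
Proof.
move=> a_t a0.
have /choice[s sP] : forall k : nat, exists s : R, [/\ a <= s < t,
    t - s < @harmonic R k &
    (P [set om | r s om != r t om] <= (1 / (2 ^ (k + 1))%:R)%:E)%E].
  move=> k; have [|dlt dlt0 H] := chain_no_fixed_jump usualF chain_r t (e := 1 / (2 ^ (k + 1))%:R).
    by rewrite divr_gt0// ltr0n expn_gt0.
  have h0 := @harmonic_gt0 R k.
  pose e := Num.min (t - a) (Num.min dlt (harmonic k)).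
  have e0 : 0 < e by rewrite !lt_min subr_gt0 a_t dlt0.
  have ea : e <= t - a by rewrite ge_min lexx.
  have ed : e <= dlt by rewrite ge_min; apply/orP; right; rewrite ge_min lexx.
  have eh : e <= harmonic k by rewrite ge_min; apply/orP; right; rewrite ge_min lexx orbT.
  (* Halving [e] makes the bounds by [dlt] and by the harmonic term strict. *)
  exists (t - e / 2); split; [by lra|by lra|].
  by apply: H; lra.
exists s; split=> [k||]; first by case: (sP k).
  apply/cvgrPdist_lt => e e0.
  have /cvgrPdist_lt/(_ e e0) := @cvg_harmonic R.
  apply: filterS => k; rewrite sub0r normrN gtr0_norm ?harmonic_gt0// => ke.
  by have [/andP[ask skt] tsk _] := sP k; rewrite gtr0_norm ?subr_gt0// (lt_trans tsk).
have t_ge0 : 0 <= t by apply: le_trans (ltW a_t).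
pose E k := [set om | r (s k) om != r t om].
have mE k : measurable (E k).
  have -> : E k = \bigcup_(i in [set: 'I_N]) (r (s k) @^-1` [set i] `&` ~` (r t @^-1` [set i])).
    apply/seteqP; split=> [om /= rst|om [i _ [/= rsi rti]]].
      by exists (r (s k) om) => //; split => //= rt; rewrite /E/= rt eqxx in rst.
    by rewrite /E/= rsi; apply/eqP => irt; exact: rti.
  apply: fin_bigcup_measurable => // i _; apply: measurableI.
    apply: (measurable_chain usualF chain_r); have [/andP[ask _] _ _] := sP k.
    exact: le_trans ask.
  by apply: measurableC; exact: (measurable_chain usualF chain_r).
have sumE : (\sum_(k <oo) P (E k) < +oo)%E.
  apply: (@le_lt_trans _ _ (\sum_(k <oo) (1 / (2 ^ (k + 1))%:R)%:E)%E).
    by apply: lee_nneseries => // k _; have [] := sP k.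
  by rewrite (cvg_lim _ (@cvg_geometric_eseries_half R 1 0))// ltry.
exists (lim_sup_set E); split.
- by apply: bigcap_measurableType => k _; exact: bigcup_measurable.
- exact: lim_sup_set_cvg0.
- move=> om /= H k _; apply: contrapT => notE; apply: H.
  exists k => // j /= kj; apply: contrapT => rj; apply: notE; exists j => //=.
  by rewrite /E/=; apply/eqP.
Qed.

(** If all means just before [t] were at most the mean at [t] minus [eta], Fatou's lemma for the
    nonnegative functional along a left sequence would yield the same bound at [t], a
    contradiction. *)
Lemma expected_value_left_limit t0 xi x t (eta dlt : R) : 0 <= t0 ->
  initial_condition F t0 xi -> sol t0 xi x -> t0 < t -> 0 < eta -> 0 < dlt ->
  exists s, [/\ t0 <= s, s < t, t - dlt < s &
    \int[P]_om value_along V x t om <= \int[P]_om value_along V x s om + eta].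
Proof.
move=> t00 xiF solx t0t eta0 dlt0; apply: contrapT => noS.
pose v s := \int[P]_om value_along V x s om.
have vlow s : t0 <= s -> s < t -> t - dlt < s -> v s <= v t - eta.
  move=> t0s st sd; rewrite leNgt; apply/negP => h; apply: noS; exists s; split => //.
  by rewrite -/(v t) -/(v s); lra.
(* This choice of [a] keeps the whole sequence inside the window where [vlow] applies, strictly
   above [t - dlt]. *)
pose a := Num.max t0 (t - dlt / 2).
have [||s [ast st rs]] := @chain_left_sequence t a.
- by rewrite gt_max t0t /=; lra.
- by rewrite le_max t00.
have t0s k : t0 <= s k by have /andP[+ _] := ast k; rewrite ge_max => /andP[].
have iV u : t0 <= u -> P.-integrable setT (EFin \o value_along V x u).
  by move=> t0u; have [] := right_derivative_value t00 xiF solx t0u.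
have cV := value_along_cvg t00 solx (ltW t0t) t0s st rs.
have fat := @fatou _ _ _ P setT measurableT (fun k om => (value_along V x (s k) om)%:E).
have : ((v t)%:E <= (v t - eta)%:E)%E.
  have -> : ((v t)%:E = \int[P]_om limn_einf (fun k => (value_along V x (s k) om)%:E))%E.
    rewrite /v /Rintegral fineK; last by rewrite integrable_fin_num// iV// ltW.
    have cP : measure_is_complete P by case: usualF.
    have E : ae_eq P setT (EFin \o value_along V x t)
        (fun om => limn_einf (fun k => (value_along V x (s k) om)%:E)).
      apply: filterS cV => om Vom _; apply/esym.
      have /cvg_limn_einf_sup[] // : (value_along V x (s k) om)%:E @[k --> \oo] -->
        (value_along V x t om)%:E by apply: cvg_EFin => //; exact: nearW.
    have mVt := measurable_int _ (iV t (ltW t0t)).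
    by apply: ae_eq_integral => //; exact: (ae_measurable_fun cP E).
  apply: le_trans (fat _ _) _.
  - by move=> k; exact: measurable_int (iV _ (t0s k)).
  - by move=> k om _; rewrite lee_fin V_ge0// (le_trans t00).
  rewrite limn_einf_lim; apply: lime_le; first exact: is_cvg_einfs.
  apply: nearW => k; apply: (@le_trans _ _ (\int[P]_om (value_along V x (s k) om)%:E)%E).
    by apply: ereal_inf_lbound; exists k => //=.
  rewrite -[leLHS]fineK ?integrable_fin_num ?iV// lee_fin; apply: vlow => //.
    by have /andP[] := ast k.
  by have /andP[+ _] := ast k; rewrite ge_max => /andP[_]; lra.
by rewrite lee_fin; lra.
Qed.

(** * Moment estimates from the comparison functions *)

Context (alpha1 alpha2 : R -> R) (p eps delta : R).
Hypothesis p_gt0 : 0 < p.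
Hypothesis mu_cont : {within `[0, +oo[, continuous mu}.
Hypothesis mu_int : forall t0 t : R, 0 <= t0 -> t0 <= t ->
  \int[lebesgue_measure]_(s in `[t0, t]) mu s <= - eps * (t - t0) + delta.
Hypothesis Ka1 : classVKoo alpha1.
Hypothesis Ka2 : classCKoo alpha2.
Hypothesis V_bounds : forall (t : R) (phi : hist n tau) i, 0 <= t ->
  alpha1 (enorm (phi 0) `^ p) <= V t phi i /\
  V t phi i <= alpha2 (hnorm phi `^ p).

Lemma initial_moment t0 (xi : Omega -> hist n tau) : 0 <= t0 -> initial_condition F t0 xi ->
  P.-integrable setT (EFin \o (fun om => hnorm (xi om) `^ p)).
Proof.
move=> t00 [xiF [M xiM]].
have mX : measurable_fun setT (fun om => hnorm (xi om) `^ p).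
  apply: (@measurableT_comp _ _ _ _ _ _ (fun c : R => c `^ p)).
    exact: measurable_powR.
  apply: (@measurableT_comp _ _ _ _ _ _ (@hnorm R n tau)).
    exact: measurable_hnorm.
  by move=> _ B mB; rewrite setTI; apply: (mF t00); exact: xiF.
apply: measurable_bounded_integrable => //.
  by rewrite (le_lt_trans (probability_le1 _ _)) ?ltry.
exists (Num.max M 0 `^ p); split; first exact: num_real.
move=> B MB om _; apply: le_trans (ltW MB).
rewrite ger0_norm ?powR_ge0//; apply: ge0_ler_powR; first exact: ltW.
- by rewrite nnegrE hnorm_ge0.
- by rewrite nnegrE le_max lexx orbT.
- by rewrite le_max xiM.
Qed.

Lemma expected_value_decay t0 xi x t : 0 <= t0 -> initial_condition F t0 xi ->
  sol t0 xi x -> t0 <= t ->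
  \int[P]_om value_along V x t om <=
  expR (delta - eps * (t - t0)) * alpha2 (fine ('E_P[fun om => (hnorm (xi om) `^ p)%R])%E).
Proof.
move=> t00 xiF solx t0t.
have iX := initial_moment t00 xiF.
have cP : measure_is_complete P by case: usualF.
have mseg := measurable_segment t00 xiF solx (lexx t0).
have [_ x0 _ _ _] := solx.
(* The bounds on [V] concern the actual initial segment, which equals [xi] only almost surely; [X]
   has the same mean as the moment of [xi]. *)
pose X om := hnorm (segment tau (x ^~ om) t0) `^ p.
have mX : measurable_fun setT X.
  apply: (@measurableT_comp _ _ _ _ _ _ (fun c : R => c `^ p)).
    exact: measurable_powR.
  apply: (@measurableT_comp _ _ _ _ _ _ (@hnorm R n tau)) => //.
  exact: measurable_hnorm.
have Xxi : {ae P, forall om, X om = hnorm (xi om) `^ p}.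
  by apply: filterS x0 => om; rewrite /X => ->.
have iX' : P.-integrable setT (EFin \o X).
  apply/integrableP; split; first exact/measurable_EFinP.
  have /integrableP[mXxi] := iX; apply: le_lt_trans.
  rewrite le_eqVlt; apply/orP; left; apply/eqP; apply: ae_eq_integral.
  - exact: measurableT.
  - by apply: (measurableT_comp (@abse_measurable R setT)); exact/measurable_EFinP.
  - exact: (measurableT_comp (@abse_measurable R setT) mXxi).
  - apply: filterS Xxi => om Xom _; rewrite /= Xom; reflexivity.
have -> : ('E_P[fun om => (hnorm (xi om) `^ p)%R] = (\int[P]_om X om)%:E)%E.
  by rewrite -(expectation_integrable iX'); apply/esym; exact: ae_eq_expectation Xxi.
rewrite /=.
have V_init : \int[P]_om value_along V x t0 om <= alpha2 (\int[P]_om X om).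
  apply: le_concave_Rintegral => //.
  - by have [] := right_derivative_value t00 xiF solx (lexx t0).
  - by move=> om; exact: powR_ge0.
  - by move=> om; have [] := V_bounds (segment tau (x ^~ om) t0) (r t0 om) t00.
have V_pos s : t0 <= s -> 0 <= \int[P]_om value_along V x s om.
  by move=> t0s; apply: Rintegral_ge0 => om _; rewrite V_ge0// (le_trans t00).
apply: (le_trans (linear_comparison (l := fun s => \int[P]_om value_along LV x s om)
  t00 mu_cont V_pos _ _ _ t0t)).
- by move=> s t0s; have [] := right_derivative_value t00 xiF solx t0s.
- by move=> s t0s; exact: (expected_operator_le t00 xiF solx t0s).
- by move=> s t0s e h e0 h0; exact: (expected_value_left_limit t00 xiF solx t0s e0 h0).
rewrite mulrC; apply: ler_pM.
- exact: expR_ge0.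
- exact: (V_pos t0 (lexx t0)).
- by rewrite ler_expR; have := mu_int t00 t0t; lra.
- exact: V_init.
Qed.

(** Leaving [y] free serves both forms of stability: the inverse of [alpha1] supplies it in general,
    an explicit power expression in the exponential case. *)
Lemma moment_bound t0 xi x t y : 0 <= t0 -> initial_condition F t0 xi ->
  sol t0 xi x -> t0 <= t -> 0 <= y ->
  expR (delta - eps * (t - t0)) * alpha2 (fine ('E_P[fun om => (hnorm (xi om) `^ p)%R])%E) <=
    alpha1 y ->
  ('E_P[fun om => (enorm (x t om) `^ p)%R] <= y%:E)%E.
Proof.
move=> t00 xiF solx t0t y0 Vy; have [cx _ _ _ _] := solx.
have xE om : x t om = segment tau (x ^~ om) t 0.
  by rewrite (segmentE tau0 (cx om) t0t) clampE ?addr0// oppr_le0 tau0 lexx.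
apply: (expectation_le_convex (a := alpha1) (Y := value_along V x t)) => //.
- apply: (@measurableT_comp _ _ _ _ _ _ (fun c : R => c `^ p)).
    exact: measurable_powR.
  under eq_fun do rewrite xE.
  apply: (@measurableT_comp _ _ _ _ _ _ (fun phi : hist n tau => enorm (phi 0))).
    exact: measurable_enorm_eval.
  exact: (measurable_segment t00 xiF solx t0t).
- by have [] := right_derivative_value t00 xiF solx t0t.
- by move=> om; exact: powR_ge0.
- by move=> om; rewrite xE; have [] := V_bounds (segment tau (x ^~ om) t) (r t om)
    (le_trans t00 t0t).
- exact: le_trans (expected_value_decay t00 xiF solx t0t) Vy.
Qed.

End Solutions.

Theorem corollary3 (R : realType) (n m l N : nat) (tau p : R)
  (d : measure_display) (Omega : measurableType d) (P : probability Omega R)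
  (F : R -> set (set Omega))
  (w : R -> Omega -> 'cV[R]_m)
  (Gamma : 'M[R]_N) (r : R -> Omega -> 'I_N)
  (f : R -> hist n tau -> 'I_N -> 'cV[R]_l -> 'cV[R]_n)
  (g : R -> hist n tau -> 'I_N -> 'cV[R]_l -> 'M[R]_(n, m))
  (V LV : R -> hist n tau -> 'I_N -> R)
  (mu alpha1 alpha2 : R -> R)
  (tau_ge0 : 0 <= tau) (p_gt0 : 0 < p)
  (usualF : usual_conditions P F)
  (bm_w : brownian_motion P F w)
  (gen_Gamma : is_generator Gamma)
  (chain_r : markov_chain P F Gamma r)
  (indep_rw : independent_sigma P (sigma_chain r) (sigma_brownian w))
  (adm_f : admissible_drift f) (adm_g : admissible_diffusion g)
  (solvable_fg : globally_solvable P F w r f g (fun=> 0))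
  (V_ge0 : forall (t : R) (phi : hist n tau) (i : 'I_N), - tau <= t -> 0 <= V t phi i)
  (V_cont : continuous_functional V)
  (LV_op : is_infinitesimal_operator P F w r f g (fun=> 0) V LV)
  (usf_mu : uniformly_stable_function mu)
  (VK_alpha1 : classVKoo alpha1) (CK_alpha2 : classCKoo alpha2)
  (cond_i : forall (t : R) (phi : hist n tau) (i : 'I_N), 0 <= t ->
     alpha1 (enorm (phi 0) `^ p) <= V t phi i /\
     V t phi i <= alpha2 (hnorm phi `^ p))
  (cond_ii : forall (t0 : R) xi x (t : R) i, 0 <= t0 -> initial_condition F t0 xi ->
     is_solution P F w r f g (fun=> 0) t0 xi x -> t0 <= t ->
     ('E_P[fun om => LV t (segment tau (x ^~ om) t) i] <=
      (mu t)%:E * 'E_P[fun om => V t (segment tau (x ^~ om) t) i])%E) :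
  pGUAS P F w r f g (fun=> 0) p /\
  ((exists beta0 beta1 beta2 : R,
      [/\ 0 < beta0, 0 < beta1, 0 < beta2,
          forall s : R, 0 <= s -> alpha1 s = beta1 * s `^ beta0 &
          forall s : R, 0 <= s -> alpha2 s = beta2 * s `^ beta0]) ->
   pGUES P F w r f g (fun=> 0) p).
Proof.
have [mu_cont [eps [delta [eps0 delta0 mu_int]]]] := usf_mu.
have Vge (t : R) phi i : 0 <= t -> 0 <= V t phi i.
  by move=> t0; apply: V_ge0; lra.
have K1 : classK alpha1 by case: VK_alpha1 => -[].
have K2 : classK alpha2 by case: CK_alpha2 => -[].
have V0 (t : R) i : 0 <= t -> V t (chist 0) i = 0.
  move=> t0; apply/eqP; rewrite eq_le Vge// andbT.
  have [_] := cond_i t (chist 0) i t0.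
  by rewrite hnorm_chist0// powR0 ?gt_eqF//; case: K2 => _ _ ->.
have bound := moment_bound tau_ge0 usualF chain_r V_cont LV_op adm_f.2 adm_g.2
  solvable_fg Vge V0 cond_ii p_gt0 mu_cont mu_int VK_alpha1 CK_alpha2 cond_i.
have moment t0 xi : 0 <= t0 -> initial_condition F t0 xi ->
    P.-integrable setT (EFin \o (fun om => hnorm (xi om : hist n tau) `^ p)).
  by move=> t00; exact: initial_moment.
have moment_ge0 (xi : Omega -> hist n tau) :
    0 <= fine 'E_P[fun om => (hnorm (xi om) `^ p)%R]%E.
  by rewrite fine_ge0// expectation_ge0// => om; exact: powR_ge0.
split.
  have [b [Kb bP]] := classKoo_inverse VK_alpha1.1.
  exists (fun s t => b (expR (delta - eps * t) * alpha2 s)).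
    exact: classKL_exponential.
  move=> t0 xi x t t00 xiF solx t0t.
  have z0 : 0 <= expR (delta - eps * (t - t0)) *
      alpha2 (fine 'E_P[fun om => (hnorm (xi om) `^ p)%R]%E).
    by rewrite mulr_ge0 ?expR_ge0// classK_ge0.
  have [bz0 bz] := bP _ z0.
  by apply: (bound t0 xi x t) => //; rewrite bz.
move=> [b0 [b1 [b2 [b0_gt0 b1_gt0 b2_gt0 E1 E2]]]].
(* These constants come from solving $b_1 y^{b_0} = e^{\delta - \varepsilon (t - t_0)} b_2 s^{b_0}$
   for $y$, where $s$ is the initial moment. *)
exists (eps / b0), ((expR delta * b2 / b1) `^ b0^-1); split.
- by rewrite divr_gt0.
- by rewrite powR_gt0// divr_gt0// mulr_gt0// expR_gt0.
move=> t0 xi x t t00 xiF solx t0t.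
have iX := moment _ _ t00 xiF.
set s := fine 'E_P[fun om => (hnorm (xi om) `^ p)%R]%E.
have s0 : 0 <= s by exact: moment_ge0.
have -> : ('E_P[fun om => (hnorm (xi om) `^ p)%R] = s%:E)%E.
  by rewrite /s expectation_integrable.
set c := expR delta * b2 / b1.
have c0 : 0 < c by rewrite divr_gt0// mulr_gt0// expR_gt0.
rewrite -EFinM; apply: (bound t0 xi x t) => //.
  by rewrite !mulr_ge0 ?powR_ge0 ?expR_ge0.
rewrite -/s E1 ?mulr_ge0 ?powR_ge0 ?expR_ge0// E2//.
rewrite powRM ?mulr_ge0 ?powR_ge0 ?expR_ge0// powRM ?powR_ge0 ?expR_ge0//.
rewrite -powRrM mulVf ?gt_eqF// powRr1 ?(ltW c0)//.
have -> : expR (- (eps / b0) * (t - t0)) `^ b0 = expR (- eps * (t - t0)).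
  by rewrite -expRM; congr expR; field; rewrite gt_eqF.
rewrite /c (_ : delta - _ = delta + - eps * (t - t0)); last by ring.
rewrite expRD le_eqVlt; apply/orP; left; apply/eqP.
by field; rewrite gt_eqF.
Qed.
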